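(* Let $\mathfrak n=\bigoplus_{\ell>0}g_{(\ell)}$ be the positive-level subalgebra of the Kac--Moody algebra $g=A_1^{++}$. For an odd positive integer $m$, define $$D_m=\sum_{i=0}^m(-1)^i\operatorname{ch}H_i(\mathfrak n,\mathbb C).$$ Then the formal series $D_m^{-1}$ and $-\log D_m$ have nonnegative coefficients, and for all integers $\ell>0$, $d$, $s$, $$m(\ell,d,s)\le[t^\ell q^dz^s]\,(-\log D_m).$$
   Context: $g=g(A)$ is the complex Kac--Moody algebra with Cartan matrix $A=\begin{pmatrix}2&-1&0\\-1&2&-2\\0&-2&2\end{pmatrix}$, indexed by $-1,0,1$, with simple roots $\alpha_{-1},\alpha_0,\alpha_1$. For integers $\ell,d,s$ put $\alpha=\ell\alpha_{-1}+d\alpha_0+(d+s)\alpha_1$ and $m(\ell,d,s)=\dim g_\alpha$ ($0$ if $\alpha$ is not a root); $\ell$ is the level. For $\ell>0$, $g_{(\ell)}$ is the sum of all root spaces of level $\ell$. $H_i(\mathfrak n,\mathbb C)$ is Lie algebra homology with trivial coefficients, graded by the root lattice, with finite-dimensional graded pieces. For a vector space $M$ graded by the nonnegative integer span of the simple roots with finite-dimensional pieces, $\operatorname{ch}M=\sum_{\ell,d,s}\dim M_{\ell,d,s}\,t^\ell q^dz^s$, where $M_{\ell,d,s}$ is the piece of degree $\ell\alpha_{-1}+d\alpha_0+(d+s)\alpha_1$. Characters are formal series in the ring completed by height $\ell+2d+s$ (the sum of simple-root coefficients), so inverses and logarithms of series with constant term $1$ are well-defined. *)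

(* Defs.v *)
From HB Require Import structures.
From mathcomp.multinomials Require Import freeg.
From mathcomp Require Import all_boot all_order all_algebra.
From mathcomp Require Import boolp classical_sets reals.
From mathcomp Require Import complex zify.

Set Implicit Arguments.
Unset Strict Implicit.
Unset Printing Implicit Defensive.

Import Order.TTheory GRing.Theory Num.Theory.

Local Open Scope classical_set_scope.
Local Open Scope ring_scope.
Local Open Scope quotient_scope.

Inductive in_span (K : fieldType) (V : lmodType K) (S : set V) : V -> Prop :=
| in_span0 : in_span S 0
| in_spanD a x y : S x -> in_span S y -> in_span S (a *: x + y).

Definition lspan (K : fieldType) (V : lmodType K) (S : set V) : {pred V} :=
  fun x => `[< in_span S x >].

Section Span.
Variables (K : fieldType) (V : lmodType K) (S : set V).

Lemma lspanP x : reflect (in_span S x) (x \in lspan S).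
Proof. exact: asboolP. Qed.

Lemma lspan_incl x : S x -> x \in lspan S.
Proof.
by move=> Sx; apply/lspanP; rewrite -[x]addr0 -[x]scale1r; apply: in_spanD => //;
   apply: in_span0.
Qed.

Lemma lspan_submod : subsemimod_closed (lspan S).
Proof.
split; [split|].
- by apply/lspanP; apply: in_span0.
- move=> x y /lspanP Sx /lspanP Sy; apply/lspanP.
  elim: Sx => [|a u v Su _ IH]; first by rewrite add0r.
  by rewrite -addrA; apply: in_spanD.
- move=> a x /lspanP Sx; apply/lspanP.
  elim: Sx => [|b u v Su _ IH]; first by rewrite scaler0; apply: in_span0.
  by rewrite scalerDr scalerA; apply: in_spanD.
Qed.

HB.instance Definition _ := GRing.isSubmodClosed.Build K V (lspan S) lspan_submod.

Definition modquot := {ideal_quot (lspan S)}.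

HB.instance Definition _ := GRing.Zmodule.on modquot.
HB.instance Definition _ := EqQuotient.on modquot.

Definition mq_scale (a : K) (x : modquot) : modquot := \pi_modquot (a *: repr x).

Lemma mq_eq x y : (x == y %[mod modquot]) = (x - y \in lspan S).
Proof. by rewrite Quotient.idealrBE. Qed.

Lemma mq_piD x y : \pi_modquot (x + y) = \pi_modquot x + \pi_modquot y.
Proof. exact: (@Quotient.pi_add V (lspan S)). Qed.

Lemma mq_scaleE a x : mq_scale a (\pi_modquot x) = \pi_modquot (a *: x).
Proof.
by apply/eqP; rewrite mq_eq -scalerBr; apply: rpredZ; rewrite -mq_eq reprK.
Qed.

Lemma mq_scaleA a b v : mq_scale a (mq_scale b v) = mq_scale (a * b) v.
Proof. by rewrite -[v]reprK [mq_scale b _]mq_scaleE !mq_scaleE scalerA. Qed.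
Lemma mq_scale1 : left_id 1 mq_scale.
Proof. by move=> v; rewrite -[v]reprK mq_scaleE scale1r. Qed.
Lemma mq_scaleDr : right_distributive mq_scale +%R.
Proof.
by move=> a u v; rewrite -[u]reprK -[v]reprK -mq_piD !mq_scaleE scalerDr mq_piD.
Qed.
Lemma mq_scaleDl v : {morph mq_scale^~ v : a b / a + b}.
Proof. by move=> a b; rewrite -[v]reprK !mq_scaleE scalerDl mq_piD. Qed.

HB.instance Definition _ := GRing.Zmodule_isLmodule.Build K modquot
  mq_scaleA mq_scale1 mq_scaleDr mq_scaleDl.

Definition mqpi (x : V) : modquot := \pi_modquot x.

Lemma mqpi_linear a x y : mqpi (a *: x + y) = a *: mqpi x + mqpi y.
Proof. by rewrite /mqpi mq_piD -mq_scaleE. Qed.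

HB.instance Definition _ := GRing.isLinear.Build K V modquot *:%R mqpi mqpi_linear.

Lemma mqpi_eq x y : (mqpi x == mqpi y) = (x - y \in lspan S).
Proof. exact: mq_eq. Qed.

Lemma mqpi_repr (x : modquot) : mqpi (repr x) = x.
Proof. exact: reprK. Qed.

End Span.

Arguments mqpi {K V} S x.

Definition is_basis (K : fieldType) (V : lmodType K) (S : set V) (n : nat)
    (v : 'I_n -> V) : Prop :=
  [/\ forall i, S (v i),
      forall c : 'I_n -> K, \sum_i c i *: v i = 0 -> forall i, c i = 0
    & forall x, S x -> exists c : 'I_n -> K, x = \sum_i c i *: v i].

(** Dimension of a subspace [S]; the value [0] for infinite-dimensional [S] is
    a default. *)
Definition vdim (K : fieldType) (V : lmodType K) (S : set V) : nat :=
  xget 0%N [set n | exists v : 'I_n -> V, is_basis S v].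

HB.mixin Record Lmodule_isLie (K : fieldType) L of GRing.Lmodule K L := {
  lie : L -> L -> L;
  lie_linearl : forall a x y z, lie (a *: x + y) z = a *: lie x z + lie y z;
  lie_linearr : forall a x y z, lie z (a *: x + y) = a *: lie z x + lie z y;
  liexx : forall x, lie x x = 0;
  lie_jacobi : forall x y z,
    lie x (lie y z) + lie y (lie z x) + lie z (lie x y) = 0
}.

#[short(type="lieType")]
HB.structure Definition LieAlgebra (K : fieldType) :=
  {L of GRing.Lmodule K L & Lmodule_isLie K L}.

Definition lie_ideal (K : fieldType) (L : lieType K) (I : set L) : Prop :=
  [/\ I 0, forall a x y, I x -> I y -> I (a *: x + y)
    & forall x y, I y -> I (lie x y)].

(** The span of [ad_orbit S] is the ideal generated by [S]. *)
Inductive ad_orbit (K : fieldType) (L : lieType K) (S : set L) : L -> Prop :=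
| ad_orbit0 x : S x -> ad_orbit S x
| ad_orbitS y x : ad_orbit S x -> ad_orbit S (lie y x).

Section LieTheory.
Variables (K : fieldType) (L : lieType K).
Implicit Types x y z : L.

Lemma lieDl x y z : lie (x + y) z = lie x z + lie y z.
Proof. by rewrite -[x in LHS]scale1r lie_linearl scale1r. Qed.
Lemma lieDr x y z : lie z (x + y) = lie z x + lie z y.
Proof. by rewrite -[x in LHS]scale1r lie_linearr scale1r. Qed.
Lemma lie0l z : lie 0 z = 0.
Proof. by apply: (addrI (lie 0 z)); rewrite -lieDl !addr0. Qed.
Lemma lie0r z : lie z 0 = 0.
Proof. by apply: (addrI (lie z 0)); rewrite -lieDr !addr0. Qed.
Lemma lieZl a x z : lie (a *: x) z = a *: lie x z.
Proof. by rewrite -[a *: x]addr0 lie_linearl lie0l addr0. Qed.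
Lemma lieZr a x z : lie z (a *: x) = a *: lie z x.
Proof. by rewrite -[a *: x]addr0 lie_linearr lie0r addr0. Qed.
Lemma lieC x y : lie y x = - lie x y.
Proof.
apply/eqP; rewrite -addr_eq0; apply/eqP.
by have := liexx (x + y); rewrite lieDl !lieDr !liexx addr0 add0r addrC.
Qed.
Lemma lieNl x z : lie (- x) z = - lie x z.
Proof. by rewrite -scaleN1r lieZl scaleN1r. Qed.
Lemma lieNr x z : lie z (- x) = - lie z x.
Proof. by rewrite -scaleN1r lieZr scaleN1r. Qed.

Lemma ad_orbit_span (S : set L) x y :
  y \in lspan (ad_orbit S) -> lie x y \in lspan (ad_orbit S).
Proof.
move=> /lspanP; elim=> [|a u v Su _ IH]; first by rewrite lie0r rpred0.
by rewrite lie_linearr rpredD // rpredZ // lspan_incl //; apply: ad_orbitS.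
Qed.

End LieTheory.

Definition liequot (K : fieldType) (L : lieType K) (S : set L) :=
  modquot (ad_orbit S).

Section LieQuotient.
Variables (K : fieldType) (L : lieType K) (S : set L).
Local Notation Q := (liequot S).

HB.instance Definition _ := GRing.Lmodule.on Q.

Definition lqpi (x : L) : Q := mqpi (ad_orbit S) x.

Lemma lqpi_linear a x y : lqpi (a *: x + y) = a *: lqpi x + lqpi y.
Proof. exact: mqpi_linear. Qed.

HB.instance Definition _ := GRing.isLinear.Build K L Q *:%R lqpi lqpi_linear.

Definition lq_lie (x y : Q) : Q := lqpi (lie (repr x) (repr y)).

Lemma lq_lieE x y : lq_lie (lqpi x) (lqpi y) = lqpi (lie x y).
Proof.
apply/eqP; rewrite mqpi_eq.
set x' := repr _; set y' := repr _.
have hx : x' - x \in lspan (ad_orbit S) by rewrite -mqpi_eq mqpi_repr.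
have hy : y' - y \in lspan (ad_orbit S) by rewrite -mqpi_eq mqpi_repr.
have -> : lie x' y' - lie x y = lie x' (y' - y) - lie y (x' - x).
  by rewrite !lieDr !lieNr (lieC y x') (lieC y x) opprD opprK addrA subrK.
by rewrite rpredB // ad_orbit_span.
Qed.

Lemma lqpi_repr (x : Q) : lqpi (repr x) = x.
Proof. exact: mqpi_repr. Qed.

Lemma lq_linearl a x y z :
  lq_lie (a *: x + y) z = a *: lq_lie x z + lq_lie y z.
Proof.
rewrite -[x]lqpi_repr -[y]lqpi_repr -[z]lqpi_repr -linearP !lq_lieE.
by rewrite lie_linearl linearP.
Qed.
Lemma lq_linearr a x y z :
  lq_lie z (a *: x + y) = a *: lq_lie z x + lq_lie z y.
Proof.
rewrite -[x]lqpi_repr -[y]lqpi_repr -[z]lqpi_repr -linearP !lq_lieE.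
by rewrite lie_linearr linearP.
Qed.
Lemma lq_xx x : lq_lie x x = 0.
Proof. by rewrite -[x]lqpi_repr lq_lieE liexx linear0. Qed.
Lemma lq_jacobi x y z :
  lq_lie x (lq_lie y z) + lq_lie y (lq_lie z x) + lq_lie z (lq_lie x y) = 0.
Proof.
rewrite -[x]lqpi_repr -[y]lqpi_repr -[z]lqpi_repr !lq_lieE -!linearD.
by rewrite lie_jacobi linear0.
Qed.

HB.instance Definition _ := Lmodule_isLie.Build K Q
  lq_linearl lq_linearr lq_xx lq_jacobi.

End LieQuotient.

Arguments lqpi {K L} S x.

Inductive lterm (K : fieldType) (X : Type) : Type :=
| LGen of X
| LZero
| LAdd of lterm K X & lterm K X
| LScale of K & lterm K X
| LLie of lterm K X & lterm K X.

Arguments LGen {K X}.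
Arguments LZero {K X}.

HB.instance Definition _ K X := gen_eqMixin (lterm K X).
HB.instance Definition _ K X := gen_choiceMixin (lterm K X).

Inductive lcong (K : fieldType) (X : Type) : lterm K X -> lterm K X -> Prop :=
| lc_refl t : lcong t t
| lc_sym t u : lcong t u -> lcong u t
| lc_trans t u v : lcong t u -> lcong u v -> lcong t v
| lc_add t t' u u' : lcong t t' -> lcong u u' -> lcong (LAdd t u) (LAdd t' u')
| lc_scale a t t' : lcong t t' -> lcong (LScale a t) (LScale a t')
| lc_lie t t' u u' : lcong t t' -> lcong u u' -> lcong (LLie t u) (LLie t' u')
| lc_addA t u v : lcong (LAdd t (LAdd u v)) (LAdd (LAdd t u) v)
| lc_addC t u : lcong (LAdd t u) (LAdd u t)
| lc_add0 t : lcong (LAdd LZero t) t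
| lc_addN t : lcong (LAdd (LScale (-1) t) t) LZero
| lc_scaleA a b t : lcong (LScale a (LScale b t)) (LScale (a * b) t)
| lc_scale1 t : lcong (LScale 1 t) t
| lc_scaleDr a t u :
    lcong (LScale a (LAdd t u)) (LAdd (LScale a t) (LScale a u))
| lc_scaleDl a b t :
    lcong (LScale (a + b) t) (LAdd (LScale a t) (LScale b t))
| lc_linl a t u v :
    lcong (LLie (LAdd (LScale a t) u) v)
          (LAdd (LScale a (LLie t v)) (LLie u v))
| lc_linr a t u v :
    lcong (LLie v (LAdd (LScale a t) u))
          (LAdd (LScale a (LLie v t)) (LLie v u))
| lc_liexx t : lcong (LLie t t) LZero
| lc_jacobi t u v :
    lcong (LAdd (LAdd (LLie t (LLie u v)) (LLie u (LLie v t)))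
                (LLie v (LLie t u))) LZero.

Section FreeLie.
Variables (K : fieldType) (X : Type).
Local Notation T := (lterm K X).

Definition lcongb (t u : T) : bool := `[< lcong t u >].

Lemma lcongb_equiv : equiv_class_of lcongb.
Proof.
split=> [t|t u|u t v]; first by apply/asboolP/lc_refl.
  by apply/asboolP/asboolP; apply: lc_sym.
by move=> /asboolP h1 /asboolP h2; apply/asboolP; apply: lc_trans h1 h2.
Qed.

Canonical lcongb_canonical := EquivRelPack lcongb_equiv.

Definition freeLie := {eq_quot lcongb}.
HB.instance Definition _ : EqQuotient _ lcongb freeLie := EqQuotient.on freeLie.
HB.instance Definition _ := Choice.on freeLie.

Local Notation pi := (\pi_freeLie).

Lemma fl_eq t u : lcong t u -> pi t = pi u.
Proof. by move=> h; apply/eqmodP/asboolP. Qed.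

Lemma fl_repr t : lcong (repr (pi t)) t.
Proof. by apply/asboolP; move/eqmodP: (reprK (pi t)). Qed.

Definition fl_zero : freeLie := pi LZero.
Definition fl_add := lift_op2 freeLie (@LAdd K X).
Definition fl_scale a := lift_op1 freeLie (@LScale K X a).
Definition fl_lie := lift_op2 freeLie (@LLie K X).

Lemma fl_addE t u : fl_add (pi t) (pi u) = pi (LAdd t u).
Proof. by unlock fl_add; apply/fl_eq/lc_add; apply: fl_repr. Qed.
Lemma fl_scaleE a t : fl_scale a (pi t) = pi (LScale a t).
Proof. by unlock fl_scale; apply/fl_eq/lc_scale; apply: fl_repr. Qed.
Lemma fl_lieE t u : fl_lie (pi t) (pi u) = pi (LLie t u).
Proof. by unlock fl_lie; apply/fl_eq/lc_lie; apply: fl_repr. Qed.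

Local Definition flE := (fl_addE, fl_scaleE, fl_lieE).

Lemma fl_addA : associative fl_add.
Proof.
move=> x y z; rewrite -[x]reprK -[y]reprK -[z]reprK !flE.
exact/fl_eq/lc_addA.
Qed.
Lemma fl_addC : commutative fl_add.
Proof. by move=> x y; rewrite -[x]reprK -[y]reprK !flE; exact/fl_eq/lc_addC. Qed.
Lemma fl_add0 : left_id fl_zero fl_add.
Proof. by move=> x; rewrite -[x]reprK !flE; exact/fl_eq/lc_add0. Qed.
Lemma fl_addN : left_inverse fl_zero (fl_scale (-1)) fl_add.
Proof. by move=> x; rewrite -[x]reprK !flE; exact/fl_eq/lc_addN. Qed.

HB.instance Definition _ := GRing.isZmodule.Build freeLie
  fl_addA fl_addC fl_add0 fl_addN.

Lemma fl_scaleA a b x : fl_scale a (fl_scale b x) = fl_scale (a * b) x.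
Proof. by rewrite -[x]reprK !flE; exact/fl_eq/lc_scaleA. Qed.
Lemma fl_scale1 : left_id 1 fl_scale.
Proof. by move=> x; rewrite -[x]reprK !flE; exact/fl_eq/lc_scale1. Qed.
Lemma fl_scaleDr : right_distributive fl_scale +%R.
Proof.
move=> a x y.
change (fl_scale a (fl_add x y) = fl_add (fl_scale a x) (fl_scale a y)).
by rewrite -[x]reprK -[y]reprK !flE; exact/fl_eq/lc_scaleDr.
Qed.
Lemma fl_scaleDl x : {morph fl_scale^~ x : a b / a + b}.
Proof.
move=> a b; change (fl_scale (a + b) x = fl_add (fl_scale a x) (fl_scale b x)).
by rewrite -[x]reprK !flE; exact/fl_eq/lc_scaleDl.
Qed.

HB.instance Definition _ := GRing.Zmodule_isLmodule.Build K freeLie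
  fl_scaleA fl_scale1 fl_scaleDr fl_scaleDl.

Lemma fl_linearl a (x y z : freeLie) :
  fl_lie (a *: x + y) z = a *: fl_lie x z + fl_lie y z.
Proof.
change (fl_lie (fl_add (fl_scale a x) y) z =
        fl_add (fl_scale a (fl_lie x z)) (fl_lie y z)).
by rewrite -[x]reprK -[y]reprK -[z]reprK !flE; exact/fl_eq/lc_linl.
Qed.
Lemma fl_linearr a (x y z : freeLie) :
  fl_lie z (a *: x + y) = a *: fl_lie z x + fl_lie z y.
Proof.
change (fl_lie z (fl_add (fl_scale a x) y) =
        fl_add (fl_scale a (fl_lie z x)) (fl_lie z y)).
by rewrite -[x]reprK -[y]reprK -[z]reprK !flE; exact/fl_eq/lc_linr.
Qed.
Lemma fl_liexx (x : freeLie) : fl_lie x x = 0.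
Proof. by rewrite -[x]reprK !flE; exact/fl_eq/lc_liexx. Qed.
Lemma fl_jacobi (x y z : freeLie) :
  fl_lie x (fl_lie y z) + fl_lie y (fl_lie z x) + fl_lie z (fl_lie x y) = 0.
Proof.
change (fl_add (fl_add (fl_lie x (fl_lie y z)) (fl_lie y (fl_lie z x)))
  (fl_lie z (fl_lie x y)) = 0).
by rewrite -[x]reprK -[y]reprK -[z]reprK !flE; exact/fl_eq/lc_jacobi.
Qed.

HB.instance Definition _ := Lmodule_isLie.Build K freeLie
  fl_linearl fl_linearr fl_liexx fl_jacobi.

Definition flgen (x : X) : freeLie := pi (LGen x).

End FreeLie.

Arguments flgen K {X} x.

(** Chevalley generators: [KMe i], [KMf i] and the simple coroots [KMh i]. *)
Inductive kmgen (n : nat) := KMe of 'I_n | KMf of 'I_n | KMh of 'I_n.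

Section KacMoody.
Variables (K : fieldType) (n : nat) (A : 'M[int]_n).

Local Notation e i := (flgen K (KMe i)).
Local Notation f i := (flgen K (KMf i)).
Local Notation h i := (flgen K (KMh i)).

Inductive chevalley_rel : freeLie K (kmgen n) -> Prop :=
| chev_hh i j : chevalley_rel (lie (h i) (h j))
| chev_ef i j : chevalley_rel (lie (e i) (f j) - (i == j)%:R *: h i)
| chev_he i j : chevalley_rel (lie (h i) (e j) - (A i j)%:~R *: e j)
| chev_hf i j : chevalley_rel (lie (h i) (f j) + (A i j)%:~R *: f j).

(** Kac's auxiliary algebra g~(A).  The simple coroots are the chosen basis of
    the Cartan subalgebra; this is the realization of [A] only when
    [\det A != 0], as holds for [A1pp] below. *)
Definition km_aux := liequot chevalley_rel.
HB.instance Definition _ := LieAlgebra.on km_aux.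

Definition km_aux_h (i : 'I_n) : km_aux := lqpi chevalley_rel (h i).

(** The ideal generated by this union is the sum of all the ideals of g~(A)
    that meet the Cartan subalgebra trivially, i.e. the largest such ideal. *)
Definition km_radical : set km_aux :=
  [set x | exists I : set km_aux, [/\ lie_ideal I,
     forall y, I y -> y \in lspan (range km_aux_h) -> y = 0 & I x]].

Definition kacmoody := liequot km_radical.
HB.instance Definition _ := LieAlgebra.on kacmoody.

Definition km_h (i : 'I_n) : kacmoody := lqpi km_radical (km_aux_h i).

(** Value at the [i]-th simple coroot of the element [\sum_j a_j alpha_j] of the
    root lattice. *)
Definition km_weight (a : 'rV[int]_n) (i : 'I_n) : int := \sum_j A i j * a 0 j.

Lemma km_weightD a b i : km_weight (a + b) i = km_weight a i + km_weight b i.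
Proof. by rewrite -big_split; apply: eq_bigr => j _; rewrite mxE mulrDr. Qed.

Definition rootspace (a : 'rV[int]_n) : set kacmoody :=
  [set x | forall i, lie (km_h i) x = (km_weight a i)%:~R *: x].

Definition km_mult (a : 'rV[int]_n) : nat :=
  if a == 0 then 0%N else vdim (rootspace a).

Lemma rootspace_lie a b x y :
  rootspace a x -> rootspace b y -> rootspace (a + b) (lie x y).
Proof.
move=> hx hy i; have := lie_jacobi (km_h i) x y.
rewrite (lieC (km_h i) y) (hy i) (hx i) lieNr !lieZr (lieC x y) scalerN.
rewrite km_weightD intrD scalerDl => /eqP.
by rewrite -addrA -opprD subr_eq0 addrC => /eqP.
Qed.

End KacMoody.

Lemma fglift_linear (K : fieldType) (T : choiceType) (V : lmodType K) (f : T -> V) a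
    (D E : {freeg T / K}) :
  fglift f (a *: D + E) = a *: fglift f D + fglift f E.
Proof.
have add (F G : {freeg T / K}) : fglift f (F + G) = fglift f F + fglift f G.
  have sub := @lift_is_additive K T V f.
  by have := sub (F + G) G; rewrite addrK => ->; rewrite subrK.
have l0 : fglift f 0 = 0 by apply: (addrI (fglift f 0)); rewrite -add !addr0.
have sum s (c : T -> K) : fglift f (\sum_(t <- s) << c t *g t >>)
    = \sum_(t <- s) c t *: f t.
  by elim: s => [|t s IH]; rewrite ?big_nil // !big_cons add IH liftU.
rewrite add; congr (_ + _).
have -> : fglift f D = \sum_(t <- dom D) coeff t D *: f t.
  by rewrite -[in LHS](freeg_sumE D) sum.
rewrite scaler_sumr [a *: D]/(fgscale a D) sum.
by apply: eq_bigr => t _; rewrite scalerA.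
Qed.

Section Exterior.
Variables (K : fieldType) (L : lieType K).

Definition chain (n : nat) := {freeg {ffun 'I_n -> L} / K}.
HB.instance Definition _ n := GRing.Lmodule.on (chain n).

Definition tensor n (x : {ffun 'I_n -> L}) : chain n := << x >>.

Definition upd n (x : {ffun 'I_n -> L}) (i : 'I_n) (u : L) : {ffun 'I_n -> L} :=
  [ffun k => if k == i then u else x k].

Inductive ext_rel n : chain n -> Prop :=
| ext_rel_lin x i a u v :
    ext_rel (tensor (upd x i (a *: u + v))
             - (a *: tensor (upd x i u) + tensor (upd x i v)))
| ext_rel_alt (x : {ffun 'I_n -> L}) (i j : 'I_n) :
    j = i.+1 :> nat -> x i = x j -> ext_rel (tensor x).

(** Dividing the free module on [n]-tuples by [ext_rel_lin] gives the [n]-th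
    tensor power; [ext_rel_alt] then spans the degree-[n] part of the ideal of
    the tensor algebra generated by the squares [u (x) u]. *)
Definition ext n := modquot (@ext_rel n).
HB.instance Definition _ n := GRing.Lmodule.on (ext n).

Definition wedge n (x : {ffun 'I_n -> L}) : ext n := mqpi (@ext_rel n) (tensor x).

(** [x_0, ..., [x_p, x_q], ..., x_n] with the bracket in position [p] and
    position [q] removed, where [p < q]. *)
Definition contract n (x : {ffun 'I_n.+1 -> L}) (q : 'I_n.+1) (p : 'I_n) :
    {ffun 'I_n -> L} :=
  [ffun k => if k == p then lie (x (lift q p)) (x q) else x (lift q k)].

(** The Chevalley--Eilenberg formula, numbering from 0, is
    [\sum_(p < q) (-1)^(p + q) [x_p, x_q] /\ x_0 /\ ...] with [x_p] and [x_q]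
    omitted; moving the bracket to position [p] contributes [(-1)^p]. *)
Definition bd_tensor n (x : {ffun 'I_n.+1 -> L}) : ext n :=
  \sum_(q < n.+1) \sum_(p < n | (p < q)%N) (-1) ^+ q *: wedge (contract x q p).

Definition bd n (w : ext n.+1) : ext n := fglift (@bd_tensor n) (repr w).

End Exterior.

Section ExteriorTheory.
Variables (K : fieldType) (L : lieType K).

Section Wedge.
Variable n : nat.
Implicit Types (x y : {ffun 'I_n -> L}) (i j k : 'I_n).

Lemma upd_id x i : upd x i (x i) = x.
Proof. by apply/ffunP=> k; rewrite ffunE; case: eqP => // ->. Qed.

Lemma wedge_lin x i a u v :
  wedge (upd x i (a *: u + v)) = a *: wedge (upd x i u) + wedge (upd x i v).
Proof.
rewrite /wedge -mqpi_linear; apply/eqP; rewrite mqpi_eq.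
exact/lspan_incl/ext_rel_lin.
Qed.

Lemma wedge_alt x i j : j = i.+1 :> nat -> x i = x j -> wedge x = 0.
Proof.
move=> ij xij; apply/eqP; rewrite -[0](linear0 (mqpi (@ext_rel K L n))).
by rewrite /wedge mqpi_eq subr0; apply/lspan_incl/(ext_rel_alt ij).
Qed.

Lemma wedge0 x i : x i = 0 -> wedge x = 0.
Proof.
move=> xi; rewrite -(upd_id x i) xi.
by have := wedge_lin x i (-1) 0 0; rewrite scaler0 addr0 scaleN1r addNr.
Qed.

Lemma wedgeD x i u v :
  wedge (upd x i (u + v)) = wedge (upd x i u) + wedge (upd x i v).
Proof. by rewrite -[u]scale1r wedge_lin !scale1r. Qed.

Lemma wedge_swap x i j u v : j = i.+1 :> nat ->
  wedge (upd (upd x i u) j v) = - wedge (upd (upd x i v) j u).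
Proof.
move=> ij; apply/eqP; rewrite -addr_eq0; apply/eqP.
have nij : (i == j) = false by apply/eqP => e; move: ij; rewrite e; apply/n_Sn.
have updC z p q : upd (upd z i p) j q = upd (upd z j q) i p.
  apply/ffunP=> k; rewrite !ffunE.
  by case: (k =P i) => [->|_] //; rewrite nij.
have alt p : wedge (upd (upd x i p) j p) = 0.
  by apply: (wedge_alt ij); rewrite !ffunE !eqxx nij.
have := alt (u + v).
by rewrite wedgeD !updC !wedgeD -!updC !alt add0r addr0 addrC.
Qed.

End Wedge.

Lemma contract_updq n (x : {ffun 'I_n.+1 -> L}) q p u :
  contract (upd x q u) q p = upd (contract x q p) p (lie (x (lift q p)) u).
Proof.
apply/ffunP=> k; rewrite !ffunE eqxx ![_ == q]eq_sym !(negbTE (neq_lift _ _)).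
by case: eqP.
Qed.

Lemma contract_updp n (x : {ffun 'I_n.+1 -> L}) q p u :
  contract (upd x (lift q p) u) q p = upd (contract x q p) p (lie u (x q)).
Proof.
apply/ffunP=> k; rewrite !ffunE eqxx (negbTE (neq_lift _ _)).
by rewrite (inj_eq lift_inj); case: eqP.
Qed.

Lemma contract_updk n (x : {ffun 'I_n.+1 -> L}) q p k u : k != p ->
  contract (upd x (lift q k) u) q p = upd (contract x q p) k u.
Proof.
move=> kp; apply/ffunP=> l; rewrite !ffunE (negbTE (neq_lift _ _)).
rewrite !(inj_eq lift_inj) [p == k]eq_sym (negbTE kp).
by case: (l =P p) => [->|//]; rewrite eq_sym (negbTE kp).
Qed.

Lemma bd_tensor_lin n (x : {ffun 'I_n.+1 -> L}) i a u v :
  bd_tensor (upd x i (a *: u + v)) =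
  a *: bd_tensor (upd x i u) + bd_tensor (upd x i v).
Proof.
rewrite /bd_tensor scaler_sumr -big_split; apply: eq_bigr => q _ /=.
rewrite scaler_sumr -big_split; apply: eq_bigr => p _ /=.
rewrite scalerA mulrC -scalerA -scalerDr; congr (_ *: _).
case: (unliftP q i) => [k|] ->; last first.
  by rewrite !contract_updq lie_linearr wedge_lin.
have [->|kp] := eqVneq k p; first by rewrite !contract_updp lie_linearl wedge_lin.
by rewrite !contract_updk // wedge_lin.
Qed.

Lemma bd_tensor_alt n (x : {ffun 'I_n.+1 -> L}) (i j : 'I_n.+1) :
  j = i.+1 :> nat -> x i = x j -> bd_tensor x = 0.
Proof.
move=> ij xij; rewrite /bd_tensor.
have nij : j != i by apply/eqP => e; move: ij; rewrite e; apply/n_Sn.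
rewrite (bigD1 i) //= (bigD1 j) //= [X in _ + (_ + X)]big1 ?addr0; last first.
  move=> q /andP[qi qj].
  case: (unliftP q i) => [i'|] ei; last by rewrite ei eqxx in qi.
  case: (unliftP q j) => [j'|] ej; last by rewrite ej eqxx in qj.
  have vi : i = (if (q <= i')%N then i'.+1 else i') :> nat.
    by rewrite ei /= /bump; case: leqP.
  have vj : j = (if (q <= j')%N then j'.+1 else j') :> nat.
    by rewrite ej /= /bump; case: leqP.
  have qi' : q <> i :> nat by move/val_inj => e; rewrite e eqxx in qi.
  have qj' : q <> j :> nat by move/val_inj => e; rewrite e eqxx in qj.
  have [ij' lij] : j' = i'.+1 :> nat /\ (j' < q)%N = (i' < q)%N.
    by move: vi vj qi' qj' ij; case: (leqP q i'); case: (leqP q j'); lia.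
  have nij' : j' != i' by apply/eqP => e; move: ij'; rewrite e; apply/n_Sn.
  rewrite -scaler_sumr; apply/eqP; rewrite scaler_eq0; apply/orP; right; apply/eqP.
  have zero (p : 'I_n) : (p != i') && (p != j') -> wedge (contract x q p) = 0.
    move=> /andP[pi pj]; apply: (wedge_alt ij'); rewrite !ffunE.
    by rewrite eq_sym (negbTE pi) eq_sym (negbTE pj) -ei -ej.
  have [iq|iq] := boolP (i' < q)%N; last first.
    apply: big1 => p pq; apply: zero; apply/andP; split; apply/eqP => e.
      by rewrite -e pq in iq.
    by move: lij; rewrite -e pq => /esym; rewrite (negbTE iq).
  rewrite (bigD1 i') //= (bigD1 j') ?lij ?iq //= [X in _ + (_ + X)]big1 ?addr0; last first.
    by move=> p /andP[/andP[_ pi] pj]; apply: zero; rewrite pi.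
  set y := contract x q i'.
  have -> : y = upd (upd y i' (y i')) j' (y j') by rewrite !upd_id.
  rewrite wedge_swap // addrC.
  have -> : upd (upd y i' (y j')) j' (y i') = contract x q j'; last by rewrite subrr.
  apply/ffunP=> k; rewrite !ffunE eqxx (negbTE nij') -ei -ej -xij.
  by case: eqP => // _; case: (k =P i') => [->|//]; rewrite -ei.
have sgn (a b : ext L n) : (-1) ^+ i *: a + (-1) ^+ j *: b = (-1) ^+ i *: (a - b).
  by rewrite ij exprS mulN1r scaleNr scalerBr.
rewrite -!scaler_sumr sgn; apply/eqP; rewrite scaler_eq0; apply/orP; right.
have iln : (i < n)%N by move: (ltn_ord j) ij; lia.
rewrite [X in _ - X](bigD1 (Ordinal iln)) /= ?ij //.
rewrite [wedge (contract x j _)](@wedge0 _ _ (Ordinal iln)) ?add0r; last first.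
  rewrite ffunE eqxx; have -> : lift j (Ordinal iln) = i.
    by apply/val_inj; rewrite /= /bump ij ltnn.
  by rewrite xij liexx.
rewrite subr_eq0; apply/eqP.
rewrite [RHS](eq_bigl (fun p : 'I_n => (p < i)%N)); last first.
  by move=> p /=; rewrite -val_eqE /= [RHS]ltn_neqAle ltnS andbC.
apply: eq_bigr => p pi; congr wedge; apply/ffunP=> k; rewrite !ffunE.
have lp : lift i p = lift j p.
  by apply/val_inj; rewrite /= /bump ij leqNgt pi /= ltnNge (ltnW pi).
rewrite lp xij; case: eqP => // _.
have [->|ki] := eqVneq k (Ordinal iln).
  have -> : lift i (Ordinal iln) = j by apply/val_inj; rewrite /= /bump ij leqnn.
  have -> : lift j (Ordinal iln) = i by apply/val_inj; rewrite /= /bump ij ltnn.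
  by [].
congr (x _); apply/val_inj; rewrite /= /bump ij.
by move: ki; rewrite -val_eqE /= => ki; congr (_ + _)%N; rewrite ltn_neqAle eq_sym ki.
Qed.

Lemma bd_mqpi n (D : chain L n.+1) :
  bd (mqpi (@ext_rel K L n.+1) D) = fglift (@bd_tensor K L n) D.
Proof.
rewrite /bd; set E := repr _.
have /lspanP : E - D \in lspan (@ext_rel K L n.+1) by rewrite -mqpi_eq mqpi_repr.
have fD u v : fglift (@bd_tensor K L n) (u + v)
    = fglift (@bd_tensor K L n) u + fglift (@bd_tensor K L n) v.
  by rewrite -[u]scale1r fglift_linear !scale1r.
rewrite -[in fglift _ E](subrK D E) fD => H; rewrite -[RHS]add0r; congr (_ + _).
elim: H => [|a r s rr _ IH].
  by apply: (addrI (fglift (@bd_tensor K L n) 0)); rewrite -fD !addr0.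
rewrite fglift_linear IH.
have -> : fglift (@bd_tensor K L n) r = 0; last by rewrite scaler0 addr0.
case: rr => [x i b u v|x i j ij xij]; last first.
  by rewrite /tensor liftU scale1r (bd_tensor_alt ij).
rewrite -scaleN1r addrC !fglift_linear /tensor !liftU !scale1r bd_tensor_lin.
by rewrite scaleN1r addNr.
Qed.

Lemma bd_wedge n (x : {ffun 'I_n.+1 -> L}) : bd (wedge x) = bd_tensor x.
Proof. by rewrite bd_mqpi /tensor liftU scale1r. Qed.

Lemma bd_linear n a (v w : ext L n.+1) : bd (a *: v + w) = a *: bd v + bd w.
Proof.
by rewrite -[v]mqpi_repr -[w]mqpi_repr -mqpi_linear !bd_mqpi fglift_linear.
Qed.

HB.instance Definition _ n :=
  GRing.isLinear.Build K (ext L n.+1) (ext L n) *:%R (@bd K L n) (@bd_linear n).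
End ExteriorTheory.

Section Homology.
Variables (K : fieldType) (L : lieType K).

Definition cycles (n : nat) : set (ext L n) :=
  match n with
  | 0 => setT
  | m.+1 => [set w | bd w = 0]
  end.

(** [range] of a linear map is already a subspace, so this is the quotient by
    the boundaries; [H_n(L, K)] is the image of the cycles in it. *)
Definition chains_mod_bd (n : nat) := modquot (range (@bd K L n)).
HB.instance Definition _ n := GRing.Lmodule.on (chains_mod_bd n).

Definition homology (n : nat) : set (chains_mod_bd n) :=
  [set mqpi (range (@bd K L n)) z | z in @cycles n].

Variables (G : zmodType) (gr : G -> set L).

Definition ext_piece (n : nat) (a : G) : set (ext L n) :=
  [set w | in_span [set w' | exists (x : {ffun 'I_n -> L}) (b : 'I_n -> G),
     [/\ forall i, gr (b i) (x i), \sum_i b i = a & w' = wedge x]] w].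

Definition homology_piece (n : nat) (a : G) : set (chains_mod_bd n) :=
  [set mqpi (range (@bd K L n)) z | z in @cycles n `&` @ext_piece n a].

End Homology.

(** [F a b c] is the coefficient of the monomial attached to
    [a alpha_(-1) + b alpha_0 + c alpha_1], i.e. of [t^a q^b z^(c - b)]. *)
Definition fseries := nat -> nat -> nat -> rat.

Definition fs_one : fseries :=
  fun a b c => ((a == 0%N) && (b == 0%N) && (c == 0%N))%:R.

Definition fs_sub (F G : fseries) : fseries := fun a b c => F a b c - G a b c.

Definition fs_mul (F G : fseries) : fseries := fun a b c =>
  \sum_(i < a.+1) \sum_(j < b.+1) \sum_(k < c.+1)
    F i j k * G (a - i)%N (b - j)%N (c - k)%N.

Definition fs_exp (F : fseries) (k : nat) : fseries := iter k (fs_mul F) fs_one.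

(** [- log F = \sum_(k >= 1) (1 - F)^k / k] for [F] with constant term [1]: then
    [(1 - F)^k] has no term of height less than [k], so that only the [k] up to
    the height [a + b + c] contribute to the coefficient at [(a, b, c)]. *)
Definition fs_neglog (F : fseries) : fseries := fun a b c =>
  \sum_(1 <= k < (a + b + c).+1) fs_exp (fs_sub fs_one F) k a b c / k%:R.

Definition fs_nonneg (F : fseries) : Prop := forall a b c, 0 <= F a b c.

Definition root3 (a b c : int) : 'rV[int]_3 :=
  \row_(j < 3) nth 0 [:: a; b; c] j.

Definition lds (l d s : int) : 'rV[int]_3 := root3 l d (d + s).

Definition fs_coef (F : fseries) (l d s : int) : rat :=
  match l, d, d + s with
  | Posz a, Posz b, Posz c => F a b c
  | _, _, _ => 0
  end.

Definition ch (K : fieldType) (V : lmodType K) (M : 'rV[int]_3 -> set V) :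
    fseries :=
  fun a b c => (vdim (M (root3 a b c)))%:R.

(** The indices [-1, 0, 1] are the ordinals [0, 1, 2]. *)
Definition A1pp : 'M[int]_3 :=
  \matrix_(i < 3, j < 3)
    nth 0 (nth [::] [:: [::  2; -1;  0];
                        [:: -1;  2; -2];
                        [::  0; -2;  2]] i) j.

Section PositiveLevel.
Variable K : fieldType.

Local Notation g := (kacmoody K A1pp).

Definition level (a : 'rV[int]_3) : int := a 0 0.

Definition level_space (l : int) : {pred g} :=
  lspan [set x | exists2 a, level a = l & @rootspace K 3 A1pp a x].

Definition npos : {pred g} :=
  lspan [set x | exists2 l : int, 0 < l & x \in level_space l].

HB.instance Definition _ := GRing.SubmodClosed.on npos.

Lemma level_space_lie l l' x y :
  x \in level_space l -> y \in level_space l' -> lie x y \in level_space (l + l').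
Proof.
move=> /lspanP hx /lspanP hy; elim: hx => [|c u v [a la hu] _ IH].
  by rewrite lie0l rpred0.
rewrite lie_linearl rpredD // rpredZ // {IH v}.
elim: hy => [|c' u' v' [a' la' hu'] _ IH]; first by rewrite lie0r rpred0.
rewrite lie_linearr rpredD // rpredZ //; apply: lspan_incl.
by exists (a + a'); [rewrite /level mxE -la -la'|apply: rootspace_lie].
Qed.

Lemma npos_lie x y : x \in npos -> y \in npos -> lie x y \in npos.
Proof.
move=> /lspanP hx /lspanP hy; elim: hx => [|c u v [l l0 hu] _ IH].
  by rewrite lie0l rpred0.
rewrite lie_linearl rpredD // rpredZ // {IH v}.
elim: hy => [|c' u' v' [l' l0' hu'] _ IH]; first by rewrite lie0r rpred0.
rewrite lie_linearr rpredD // rpredZ //; apply: lspan_incl.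
by exists (l + l'); [rewrite addr_gt0|apply: level_space_lie].
Qed.

Definition nposLie := {x : g | x \in npos}.

HB.instance Definition _ := SubChoice.on nposLie.
HB.instance Definition _ := [SubChoice_isSubLmodule of nposLie by <:].

Definition npos_bracket (x y : nposLie) : nposLie :=
  Sub (lie (val x) (val y)) (npos_lie (valP x) (valP y)).

Lemma npos_linearl a x y z :
  npos_bracket (a *: x + y) z = a *: npos_bracket x z + npos_bracket y z.
Proof. by apply/val_inj; rewrite /= lie_linearl. Qed.
Lemma npos_linearr a x y z :
  npos_bracket z (a *: x + y) = a *: npos_bracket z x + npos_bracket z y.
Proof. by apply/val_inj; rewrite /= lie_linearr. Qed.
Lemma npos_xx x : npos_bracket x x = 0.
Proof. by apply/val_inj; rewrite /= liexx. Qed.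
Lemma npos_jacobi x y z :
  npos_bracket x (npos_bracket y z) + npos_bracket y (npos_bracket z x)
  + npos_bracket z (npos_bracket x y) = 0.
Proof. by apply/val_inj; rewrite /= lie_jacobi. Qed.

HB.instance Definition _ := Lmodule_isLie.Build K nposLie
  npos_linearl npos_linearr npos_xx npos_jacobi.

Definition npos_piece (a : 'rV[int]_3) : set nposLie :=
  [set x | @rootspace K 3 A1pp a (val x)].

Definition ch_homology (i : nat) : fseries :=
  ch (@homology_piece K nposLie _ npos_piece i).

Definition Dser (m : nat) : fseries := fun a b c =>
  \sum_(i < m.+1) (-1) ^+ i * ch_homology i a b c.

Definition mult (l d s : int) : nat := @km_mult K 3 A1pp (lds l d s).

End PositiveLevel.

(* Main.v *)
(** Let [V] be a positively graded Lie algebra with finite-dimensional pieces,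
    [x] a homogeneous element of minimal degree [delta], and [V'] an ideal with
    [V = V' + K x].  The exact sequence relating [H(V)] to the action of [x] on
    [H(V')] gives, for odd [m],
      [D_m(V) = (1 - e^delta) D_m(V') - R],
    where [R] is nonnegative: it is the character of the kernel of [x] on
    [H_m(V')].  Hence [D_m(V) = (1 - e^delta) D_m(V') (1 - Y)] with
    [Y = R / ((1 - e^delta) D_m(V'))], and by induction, up to any given height,
    [1 / D_m] is nonnegative and [- log D_m] dominates the sum of [e^delta]
    over a homogeneous basis.  On chains, the inequality says that the rank of
    [bd] on [Lambda^(m+1) V] is at most its rank on [Lambda^(m+1) V'] plus the
    corank of [bd : Lambda^(m+1) V' -> Lambda^m V'] in the degree shifted by
    [delta]. *)

(* All algebras of the induction are graded families of subspaces of one Lie algebra [L], with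
   exterior powers inside [ext L n]; no new Lie algebra is built when a vector is removed. Removing
   vectors one by one cannot exhaust an infinite-dimensional algebra, so the bounds are stated up to
   a height [N], where only finitely many basis vectors matter, and a coefficient is read with [N]
   equal to its height. A bracket of elements of positive height never lands in a minimal degree,
   which is why a hyperplane missing [x] is an ideal.

   The induction works with ranks of boundaries between pieces. Homology enters once, for the whole
   algebra: it is a quotient by all boundaries, so a boundary of degree [a] must be shown to bound a
   chain of degree [a]. The coroots achieve this: they act by derivations, and their eigenvalues
   separate degrees because [A1pp] is invertible and the characteristic is 0. Since the algebra is
   given as a quotient of a free one, positivity and finite dimension of its pieces have to be
   extracted from a spanning set of bracket words. *)
From HB Require Import structures.
From mathcomp.multinomials Require Import freeg.
Require Import Defs.
From mathcomp Require Import all_boot all_order all_algebra.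
From mathcomp Require Import boolp classical_sets reals complex zify ring lra.

Set Implicit Arguments.
Unset Strict Implicit.
Unset Printing Implicit Defensive.

Import Order.TTheory GRing.Theory Num.Theory.

Local Open Scope classical_set_scope.
Local Open Scope ring_scope.
Local Open Scope quotient_scope.

(** * Dimension of subspaces *)

Section Dimension.
Variable K : fieldType.
Implicit Types V W : lmodType K.

Definition subspace V (S : set V) :=
  S 0 /\ forall a x y, S x -> S y -> S (a *: x + y).

Definition finspan V (S : set V) :=
  exists n (v : 'I_n -> V), forall x, S x -> exists c : 'I_n -> K, x = \sum_i c i *: v i.

Definition comb V n (v : 'I_n -> V) (u : 'rV[K]_n) : V := \sum_i u 0 i *: v i.

Lemma comb_linear V n (v : 'I_n -> V) : linear (comb v).
Proof.
move=> a x y; rewrite /comb scaler_sumr -big_split; apply: eq_bigr => i _ /=.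
by rewrite !mxE scalerDl scalerA.
Qed.
HB.instance Definition _ V n (v : 'I_n -> V) :=
  GRing.isLinear.Build K 'rV[K]_n V *:%R (comb v) (comb_linear v).

Lemma comb_ffun V n (v : 'I_n -> V) (c : 'I_n -> K) :
  \sum_i c i *: v i = comb v (\row_i c i).
Proof. by apply: eq_bigr => i _; rewrite mxE. Qed.

Lemma comb_mulmx V n p (c : {linear 'rV[K]_n -> V}) (B : 'M_(p, n)) (d : 'rV_p) :
  c (d *m B) = comb (fun i => c (row i B)) d.
Proof.
by rewrite mulmx_sum_row linear_sum; apply: eq_bigr => i _; rewrite linearZ.
Qed.

(** Among the matrices with row space inside [P], one of maximal rank works: adjoining a further [u]
    in [P] cannot raise the rank. This turns subspaces given by a predicate into matrices. *)
Lemma rowspace_of n (P : set 'rV[K]_n) : subspace P ->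
  exists A : 'M[K]_n, forall u, P u <-> (u <= A)%MS.
Proof.
move=> [P0 PD].
pose Q k := `[< exists A : 'M[K]_n, \rank A = k /\ forall u, (u <= A)%MS -> P u >].
have Q0 : exists k, Q k.
  exists 0%N; apply/asboolP; exists 0; rewrite mxrank0; split=> // u.
  by rewrite submx0 => /eqP ->.
have Qn k : Q k -> (k <= n)%N by move=> /asboolP[A [<- _]]; apply: rank_leq_row.
have [k /asboolP[A [rA PA]] mk] := ex_maxnP Q0 Qn.
exists A => u; split=> [Pu|]; last exact: PA.
have Q' : Q (\rank (A + u)%MS).
  apply/asboolP; exists (A + u)%MS; split=> // w /sub_addsmxP[[w1 w2] /= ->].
  rewrite addrC [w2]mx11_scalar mul_scalar_mx; apply: PD => //.
  by apply: PA; apply: submxMl.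
have := mk _ Q'; rewrite -rA => le.
have := mxrank_leqif_sup (addsmxSl A u); move=> [le' /esym].
rewrite eqn_leq le' le => sub; apply: submx_trans (addsmxSr A u) _.
exact: sub.
Qed.

Lemma basis_img V n (c : {linear 'rV[K]_n -> V}) (A : 'M[K]_n) :
  (forall u, (u <= A)%MS -> c u = 0 -> u = 0) ->
  is_basis [set c u | u in [set u | (u <= A)%MS]]
    (fun i : 'I_(\rank A) => c (row i (row_base A))).
Proof.
move=> inj; split=> [i|d|_ [u uA <-]].
- exists (row i (row_base A)) => //=.
  by rewrite (submx_trans (row_sub _ _)) // eq_row_base.
- rewrite comb_ffun -comb_mulmx => /inj /eqP.
  rewrite (submx_trans (submxMl _ _)) ?eq_row_base // => /(_ isT).
  rewrite mulmx_free_eq0 ?row_base_free // => /eqP/rowP d0 i.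
  by have := d0 i; rewrite !mxE.
- have /submxP[D ->] : (u <= row_base A)%MS by rewrite eq_row_base.
  exists (fun i => D 0 i); rewrite comb_mulmx comb_ffun.
  by congr comb; apply/rowP => i; rewrite mxE.
Qed.

Lemma basis_comb V (S : set V) n (v : 'I_n -> V) : is_basis S v ->
  (forall u, comb v u = 0 -> u = 0) /\ (forall x, S x -> exists u, x = comb v u).
Proof.
move=> [_ fr sp]; split=> [u /fr u0|x /sp[c ->]].
  by apply/rowP => i; rewrite mxE u0.
by exists (\row_i c i); rewrite comb_ffun.
Qed.

Lemma comb_in V (S : set V) n (v : 'I_n -> V) u : subspace S ->
  (forall i, S (v i)) -> S (comb v u).
Proof.
move=> [S0 SD] Sv; rewrite /comb; apply: (big_ind S) => // [x y Sx Sy|i _].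
  by rewrite -[x]scale1r; apply: SD.
by rewrite -[_ *: _]addr0; apply: SD.
Qed.

(** The two base-change matrices satisfy [M *m N = 1%:M], which bounds the number of rows of [M]. *)
Lemma basis_leq V (S : set V) n p (v : 'I_n -> V) (w : 'I_p -> V) :
  is_basis S v -> is_basis S w -> (n <= p)%N.
Proof.
move=> bv bw; have [frv _] := basis_comb bv; have [frw spw] := basis_comb bw.
have [Sv _ spv] := bv; have [Sw _ _] := bw.
have [M hM] : exists M : 'M[K]_(n, p), forall i, v i = comb w (row i M).
  have [f hf] := choice (fun i => spw _ (Sv i)).
  by exists (\matrix_i f i) => i; rewrite rowK.
have [N hN] : exists N : 'M[K]_(p, n), forall i, w i = comb v (row i N).
  have [_ spv'] := basis_comb bv; have [f hf] := choice (fun i => spv' _ (Sw i)).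
  by exists (\matrix_i f i) => i; rewrite rowK.
have MN : M *m N = 1%:M.
  apply/row_matrixP => i; apply/eqP; rewrite -subr_eq0; apply/eqP/frv.
  rewrite linearB /= row_mul comb_mulmx /=.
  have -> : comb (fun k => comb v (row k N)) (row i M) = v i.
    by rewrite [RHS]hM; apply: eq_bigr => k _; rewrite hN.
  rewrite /comb (bigD1 i) //= big1 ?addr0 => [|j ji].
    by rewrite !mxE eqxx scale1r subrr.
  by rewrite !mxE eq_sym (negbTE ji) scale0r.
by rewrite (mulmx1_min MN).
Qed.

Lemma basis_vdim V (S : set V) n (v : 'I_n -> V) : is_basis S v -> vdim S = n.
Proof.
move=> bv; have : [set n | exists v : 'I_n -> V, is_basis S v] (vdim S).
  by apply: xgetI; exists v.
by move=> [w bw]; apply/eqP; rewrite eqn_leq (basis_leq bv bw) (basis_leq bw bv).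
Qed.

(** In coordinates on a spanning family, [A] is the preimage of [S] and [B] the space of relations;
    [comb v] is injective on the complement [A :\: B], and its image there is [S]. *)
Lemma finspan_basis V (S : set V) : subspace S -> finspan S ->
  exists v : 'I_(vdim S) -> V, is_basis S v.
Proof.
move=> Ssub [n [v spv]]; have [S0 SD] := Ssub.
have [A hA] : exists A : 'M[K]_n, forall u, S (comb v u) <-> (u <= A)%MS.
  apply: (@rowspace_of _ (fun u => S (comb v u))); split; first by rewrite linear0.
  by move=> a x y /= hx hy; rewrite linearP; apply: SD.
have [B hB] : exists B : 'M[K]_n, forall u, comb v u = 0 <-> (u <= B)%MS.
  apply: (@rowspace_of _ (fun u => comb v u = 0)); split; first by rewrite linear0.
  by move=> a x y /= hx hy; rewrite linearP /= hx hy scaler0 addr0.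
have inj u : (u <= A :\: B)%MS -> comb v u = 0 -> u = 0.
  move=> uAB /hB uB; apply/eqP; rewrite -submx0.
  by rewrite -(capmx_diff A B) sub_capmx uAB.
have bS := basis_img inj.
set S' := (X in is_basis X _) in bS.
have SS' : S' = S.
  apply/seteqP; split=> [_ [u /= uAB <-]|x Sx].
    by apply/hA; apply: submx_trans uAB (diffmxSl _ _).
  have [c] := spv _ Sx; rewrite comb_ffun => xc.
  have : (\row_i c i <= A)%MS by apply/hA; rewrite -xc.
  rewrite -(addsmx_diff_cap_eq A B) => /sub_addsmxP[[w1 w2] /= hc].
  exists (w1 *m (A :\: B)%MS) => /=; first exact: submxMl.
  rewrite xc hc linearD [X in _ = _ + X](_ : _ = 0) ?addr0 //.
  by apply/hB; apply: submx_trans (submxMl _ _) (capmxSr _ _).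
rewrite SS' in bS; have e := basis_vdim bS.
by rewrite e; eexists; exact: bS.
Qed.

Lemma finspan_sub V (S T : set V) : S `<=` T -> finspan T -> finspan S.
Proof. by move=> ST [n [v sp]]; exists n, v => x /ST/sp. Qed.

(** Rank-nullity for the restriction of [f] to [S]; the later dimension counts rest on it. In
    coordinates [B] is the kernel, and its complement maps isomorphically onto the image. *)
Lemma vdim_ker_img V W (f : {linear V -> W}) (S : set V) : subspace S -> finspan S ->
  vdim S = (vdim (S `&` [set x | f x = 0%R]) + vdim [set f x | x in S])%N.
Proof.
move=> Ssub fS; have [v bv] := finspan_basis Ssub fS.
have [fr sp] := basis_comb bv; have [Sv _ _] := bv.
have [B hB] : exists B : 'M[K]_(vdim S), forall u, f (comb v u) = 0 <-> (u <= B)%MS.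
  apply: (@rowspace_of _ (fun u => f (comb v u) = 0)); split; first by rewrite !linear0.
  by move=> a x y /= hx hy; rewrite !linearP /= hx hy scaler0 addr0.
have b1 := @basis_img _ _ (comb v : {linear _ -> _}) B (fun u _ => fr u).
have inj u : (u <= B^C)%MS -> (f \o comb v) u = 0 -> u = 0.
  move=> uB' /= /hB uB; apply/eqP; rewrite -submx0 -(capmx_compl B) sub_capmx.
  by rewrite uB uB'.
have b2 := @basis_img _ _ (f \o comb v : {linear _ -> _}) _ inj.
set S1 := (X in is_basis X _) in b1; set S2 := (X in is_basis X _) in b2.
have -> : S `&` [set x | f x = 0] = S1.
  apply/seteqP; split=> [x [/sp[u ->] /= /hB uB]|_ [u /= uB <-]]; first by exists u.
  by split; [apply: comb_in|apply/hB].
have -> : [set f x | x in S] = S2.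
  apply/seteqP; split=> [_ [x /sp[u ->] <-]|_ [u /= uB <-]]; last first.
    by exists (comb v u) => //; apply: comb_in.
  have : (u <= B + B^C)%MS by rewrite submx_full // addsmx_compl_full.
  move=> /sub_addsmxP[[w1 w2] /= ->]; exists (w2 *m B^C%MS); first exact: submxMl.
  rewrite /= !linearD [X in _ = X + _](_ : _ = 0) ?add0r //.
  by apply/hB; apply: submxMl.
rewrite (basis_vdim b1) (basis_vdim b2) mxrank_compl subnKC //.
exact: rank_leq_row.
Qed.

Lemma subspace_ker V W (f : {linear V -> W}) : subspace [set x | f x = 0].
Proof.
by split=> [|a x y /= fx fy]; rewrite /= ?linear0 // linearP fx fy scaler0 addr0.
Qed.

Lemma subspaceI V (S T : set V) : subspace S -> subspace T -> subspace (S `&` T).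
Proof.
by move=> [S0 SD] [T0 TD]; split=> // a x y [Sx Tx] [Sy Ty]; split; auto.
Qed.

Lemma subspace_img V W (f : {linear V -> W}) (S : set V) :
  subspace S -> subspace [set f x | x in S].
Proof.
move=> [S0 SD]; split; first by exists 0; rewrite ?linear0.
by move=> a _ _ [x Sx <-] [y Sy <-]; exists (a *: x + y); rewrite ?linearP; auto.
Qed.

Lemma finspan_img V W (f : {linear V -> W}) (S : set V) :
  finspan S -> finspan [set f x | x in S].
Proof.
move=> [n [v sp]]; exists n, (f \o v) => _ [x /sp[c ->] <-]; exists c.
by rewrite linear_sum; apply: eq_bigr => i _; rewrite linearZ.
Qed.

Lemma lspan_id V (S : set V) x : subspace S -> (x \in lspan S) -> S x.
Proof. by move=> [S0 SD] /lspanP; elim=> // a u v; auto. Qed.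

Lemma lspanS V (S T : set V) : S `<=` T -> {subset lspan S <= lspan T}.
Proof.
by move=> ST x /lspanP Sx; apply/lspanP; elim: Sx => [|a u v /ST]; constructor.
Qed.

Lemma subspace_lspan V (S : set V) : subspace [set x | x \in lspan S].
Proof. by split=> [|a x y /= *] /=; rewrite ?rpred0 // rpredD // rpredZ. Qed.

Lemma subspace_in_span V (S : set V) : subspace [set x | in_span S x].
Proof.
have -> : [set x | in_span S x] = [set x | x \in lspan S].
  by apply/seteqP; split=> x /= /lspanP.
exact: subspace_lspan.
Qed.

Lemma subspaceD V (S : set V) x y : subspace S -> S x -> S y -> S (x + y).
Proof. by move=> [_ SD] Sx Sy; rewrite -[x]scale1r; apply: SD. Qed.

Lemma subspaceZ V (S : set V) a x : subspace S -> S x -> S (a *: x).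
Proof. by move=> [S0 SD] Sx; rewrite -[_ *: _]addr0; apply: SD. Qed.

Lemma subspaceN V (S : set V) x : subspace S -> S x -> S (- x).
Proof. by move=> sS Sx; rewrite -scaleN1r; apply: subspaceZ. Qed.

Lemma vdimS V (S T : set V) : subspace S -> subspace T -> finspan T ->
  S `<=` T -> (vdim S <= vdim T)%N.
Proof.
move=> sS sT fT ST; pose f := @mqpi K V S.
rewrite (@vdim_ker_img _ _ f T) //.
have -> : T `&` [set x | f x = 0] = S; last exact: leq_addr.
apply/seteqP; split=> [x [Tx /= /eqP]|x Sx].
  by rewrite -(linear0 f) mqpi_eq subr0 => /lspan_id; apply.
split; first exact: ST.
by apply/eqP; rewrite /= -(linear0 f) mqpi_eq subr0; apply: lspan_incl.
Qed.

Lemma vdim_set0 V (S : set V) : (forall x, S x -> x = 0) -> vdim S = 0%N.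
Proof.
move=> S0; apply: (@basis_vdim _ _ _ (fun _ : 'I_0 => 0)); split=> [[]|c _ []|] //.
by move=> x /S0 ->; exists (fun=> 0); rewrite big_ord0.
Qed.

End Dimension.

(** * Formal power series *)

Section PowerSeries.
Variable R : comNzRingType.

(** Iterated three times over [rat], this type is convertible to [fseries], so the series of the
    theorem become elements of a commutative ring and [ring] applies to them. *)
Definition ps := nat -> R.
HB.instance Definition _ := gen_eqMixin ps.
HB.instance Definition _ := gen_choiceMixin ps.

Implicit Types F G H : ps.

Definition ps_mul F G : ps := fun n => \sum_(i < n.+1) F i * G (n - i)%N.
Definition ps_one : ps := fun n => (n == 0)%:R.

(** A coefficient of a product sees only truncations of its factors. The ring laws that are awkward
    for convolutions are thereby inherited from polynomials. *)
Lemma ps_mul_poly F G (p q : {poly R}) n :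
  (forall i, (i <= n)%N -> p`_i = F i) -> (forall i, (i <= n)%N -> q`_i = G i) ->
  ps_mul F G n = (p * q)`_n.
Proof.
move=> pF qG; rewrite coefM; apply: eq_bigr => i _.
by rewrite pF ?qG ?leq_subr // -ltnS.
Qed.

Definition ps_poly n F := \poly_(i < n.+1) F i.

Lemma ps_polyE n F i : (i <= n)%N -> (ps_poly n F)`_i = F i.
Proof. by move=> le; rewrite coef_poly ltnS le. Qed.

Lemma ps_polyM n F G i : (i <= n)%N ->
  (ps_poly n F * ps_poly n G)`_i = ps_mul F G i.
Proof.
by move=> le; symmetry; apply: ps_mul_poly => j ji;
   rewrite ps_polyE ?(leq_trans ji).
Qed.

Lemma ps_addA : associative (fun F G : ps => (fun n => F n + G n) : ps).
Proof. by move=> F G H; apply/funext => n; rewrite addrA. Qed.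
Lemma ps_addC : commutative (fun F G : ps => (fun n => F n + G n) : ps).
Proof. by move=> F G; apply/funext => n; rewrite addrC. Qed.
Lemma ps_add0 : left_id (fun=> 0 : R) (fun F G : ps => (fun n => F n + G n) : ps).
Proof. by move=> F; apply/funext => n; rewrite add0r. Qed.
Lemma ps_addN : left_inverse (fun=> 0 : R) (fun F : ps => (fun n => - F n) : ps)
  (fun F G : ps => (fun n => F n + G n) : ps).
Proof. by move=> F; apply/funext => n; rewrite addNr. Qed.
HB.instance Definition _ := GRing.isZmodule.Build ps ps_addA ps_addC ps_add0 ps_addN.

Lemma ps_addE F G n : (F + G) n = F n + G n. Proof. by []. Qed.

Lemma ps_mulA : associative ps_mul.
Proof.
move=> F G H; apply/funext => n.
rewrite (@ps_mul_poly _ _ (ps_poly n F) (ps_poly n G * ps_poly n H)); last first.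
- by move=> i; apply: ps_polyM.
- by move=> i; apply: ps_polyE.
rewrite (@ps_mul_poly _ _ (ps_poly n F * ps_poly n G) (ps_poly n H)) ?mulrA //.
- by move=> i; apply: ps_polyM.
- by move=> i; apply: ps_polyE.
Qed.
Lemma ps_mulC : commutative ps_mul.
Proof. by move=> F G; apply/funext => n; rewrite -!(@ps_polyM n) // mulrC. Qed.
Lemma ps_mul1 : left_id ps_one ps_mul.
Proof.
move=> F; apply/funext => n.
rewrite (@ps_mul_poly _ _ 1 (ps_poly n F)) ?mul1r ?ps_polyE // => i le.
  by rewrite coef1.
by rewrite ps_polyE.
Qed.
Lemma ps_mulD : left_distributive ps_mul +%R.
Proof.
move=> F G H; apply/funext => n; rewrite ps_addE -big_split.
by apply: eq_bigr => i _; rewrite ps_addE mulrDl.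
Qed.
Lemma ps_one_neq0 : ps_one != 0.
Proof. by apply/eqP => /(congr1 (@^~ 0%N))/eqP; rewrite oner_eq0. Qed.

HB.instance Definition _ := GRing.Zmodule_isComNzRing.Build ps
  ps_mulA ps_mulC ps_mul1 ps_mulD ps_one_neq0.

Lemma ps_sumE I (s : seq I) (P : pred I) (F : I -> ps) n :
  (\sum_(i <- s | P i) F i) n = \sum_(i <- s | P i) F i n.
Proof. by apply: (big_morph (fun F : ps => F n)). Qed.

Lemma ps_mulE F G n : (F * G) n = \sum_(i < n.+1) F i * G (n - i)%N.
Proof. by []. Qed.

Lemma ps1E n : (1 : ps) n = (n == 0)%:R.
Proof. by []. Qed.

End PowerSeries.

Notation fs := (ps (ps (ps rat))).

Section Series.
Implicit Types F G H : fs.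

Lemma fsD F G a b c : (F + G) a b c = F a b c + G a b c. Proof. by []. Qed.
Lemma fsN F a b c : (- F) a b c = - F a b c. Proof. by []. Qed.
Lemma fsB F G a b c : (F - G) a b c = F a b c - G a b c. Proof. by []. Qed.

Lemma fsMn F k a b c : (F *+ k) a b c = F a b c *+ k.
Proof. by elim: k => // k IH; rewrite !mulrS fsD IH. Qed.

Lemma fs_sumE I (s : seq I) (P : pred I) (F : I -> fs) a b c :
  (\sum_(i <- s | P i) F i) a b c = \sum_(i <- s | P i) F i a b c.
Proof. by rewrite !ps_sumE. Qed.

Lemma fsM F G a b c : (F * G) a b c = fs_mul F G a b c.
Proof.
rewrite ps_mulE !ps_sumE; apply: eq_bigr => i _.
by rewrite ps_mulE ps_sumE; apply: eq_bigr => j _; rewrite ps_mulE.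
Qed.

Lemma fs_mulE : fs_mul = *%R :> (fs -> fs -> fs).
Proof.
apply/funext => F; apply/funext => G; apply/funext => a; apply/funext => b.
by apply/funext => c; rewrite fsM.
Qed.

Lemma fs_oneE : fs_one = 1 :> fs.
Proof.
apply/funext => a; apply/funext => b; apply/funext => c; rewrite /fs_one.
rewrite ps1E; case: (a == 0%N) => //=; rewrite ?mulr1n ps1E.
by case: (b == 0%N) => //=; rewrite ?mulr1n ps1E.
Qed.

Lemma fs1 a b c : (1 : fs) a b c = ((a + b + c)%N == 0%N)%:R.
Proof. by rewrite -fs_oneE /fs_one !addn_eq0. Qed.

Lemma fs_expE F k : fs_exp F k = F ^+ k.
Proof. by elim: k => [|k IH]; [exact: fs_oneE|rewrite exprS -IH -fs_mulE]. Qed.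

(** The height filtration; congruence modulo its steps takes the place of convergence. *)
Definition vanish k F := forall a b c, (a + b + c < k)%N -> F a b c = 0.

Lemma vanishD k F G : vanish k F -> vanish k G -> vanish k (F + G).
Proof. by move=> vF vG a b c lt; rewrite fsD vF ?vG ?addr0. Qed.

Lemma vanishN k F : vanish k F -> vanish k (- F).
Proof. by move=> vF a b c lt; rewrite fsN vF ?oppr0. Qed.

Lemma vanishM k l F G : vanish k F -> vanish l G -> vanish (k + l) (F * G).
Proof.
move=> vF vG a b c lt; rewrite fsM; apply: big1 => i _; apply: big1 => j _.
apply: big1 => n _; have [lk|lk] := ltnP (i + j + n) k; first by rewrite vF ?mul0r.
rewrite vG ?mulr0 //; have := ltn_ord i; have := ltn_ord j; have := ltn_ord n; lia.
Qed.

Lemma vanish0 F : vanish 0 F. Proof. by []. Qed.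

Lemma vanishX k F : vanish 1 F -> vanish k (F ^+ k).
Proof.
move=> vF; elim: k => [|k IH]; first exact: vanish0.
by rewrite exprS -add1n; apply: vanishM.
Qed.

Lemma vanish_eq F G : (forall k, vanish k (F - G)) -> F = G.
Proof.
move=> v; apply/funext => a; apply/funext => b; apply/funext => c.
by apply/eqP; rewrite -subr_eq0 -fsB; apply/eqP/(v (a + b + c).+1).
Qed.

Definition unital F := F 0%N 0%N 0%N = 1.

Lemma unital_vanish F : unital F -> vanish 1 (1 - F).
Proof.
move=> uF a b c; rewrite ltnS leqn0 !addn_eq0 => /andP[/andP[/eqP-> /eqP->] /eqP->].
by rewrite fsB uF fs1 subrr.
Qed.

Lemma vanish_unital F : vanish 1 F -> unital (1 - F).
Proof. by move=> vF; rewrite /unital fsB vF // subr0 fs1. Qed.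

(** The geometric series in [1 - F], cut at the height of the coefficient: for [F] with constant
    term 1 the omitted powers do not reach that height. *)
Definition fsinv F : fs := fun a b c => \sum_(k < (a + b + c).+1) ((1 - F) ^+ k) a b c.

Lemma fsinv_geom F n : unital F ->
  vanish n (fsinv F - \sum_(k < n) (1 - F) ^+ k).
Proof.
move=> /unital_vanish vF a b c lt; rewrite fsB fs_sumE /fsinv; apply/eqP.
rewrite subr_eq0; apply/eqP; rewrite -!(big_mkord xpredT (fun k => ((1 - F) ^+ k) a b c)).
rewrite [RHS](big_cat_nat (n := (a + b + c).+1)) //= [X in _ = _ + X]big_nat.
rewrite [X in _ = _ + X]big1 ?addr0 //.
by move=> k /andP[lk _]; apply: (@vanishX k).
Qed.

Lemma mulr_fsinv F : unital F -> F * fsinv F = 1.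
Proof.
move=> uF; apply: vanish_eq => k.
have -> : F * fsinv F - 1 =
    F * (fsinv F - \sum_(i < k) (1 - F) ^+ i) + - (1 - F) ^+ k.
  have := subrX1 (1 - F) k.
  have -> : 1 - F - 1 = - F by ring.
  by move=> e; rewrite mulrBr -[_ ^+ k](subrK 1) e; ring.
apply: vanishD; last by apply/vanishN/vanishX/unital_vanish.
by rewrite -[k]add0n; apply: vanishM => //; apply: fsinv_geom.
Qed.

Lemma fsinv_uniq F G : unital F -> F * G = 1 -> G = fsinv F.
Proof.
by move=> uF FG; rewrite -[fsinv F]mulr1 -FG mulrA [_ * F]mulrC mulr_fsinv ?mul1r.
Qed.

Lemma unitalM F G : unital F -> unital G -> unital (F * G).
Proof. by rewrite /unital fsM /fs_mul !big_ord1 => -> ->; rewrite mulr1. Qed.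

Lemma fsinvM F G : unital F -> unital G -> fsinv (F * G) = fsinv F * fsinv G.
Proof.
move=> uF uG; symmetry; apply: fsinv_uniq; first exact: unitalM.
by rewrite mulrACA !mulr_fsinv ?mulr1.
Qed.

Definition euler F : fs := fun a b c => (a + b + c)%:R * F a b c.

Lemma eulerD F G : euler (F + G) = euler F + euler G.
Proof.
apply/funext => a; apply/funext => b; apply/funext => c.
by rewrite /euler !fsD mulrDr.
Qed.

Lemma eulerN F : euler (- F) = - euler F.
Proof.
apply/funext => a; apply/funext => b; apply/funext => c.
by rewrite /euler !fsN mulrN.
Qed.

Lemma euler1 : euler 1 = 0.
Proof.
apply/funext => a; apply/funext => b; apply/funext => c; rewrite /euler fs1.
by case: eqP => [->|_]; rewrite ?mul0r ?mulr0.
Qed.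

Lemma eulerM F G : euler (F * G) = euler F * G + F * euler G.
Proof.
apply/funext => a; apply/funext => b; apply/funext => c; rewrite fsD /euler !fsM.
rewrite /fs_mul mulr_sumr -big_split; apply: eq_bigr => i _ /=.
rewrite mulr_sumr -big_split; apply: eq_bigr => j _ /=.
rewrite mulr_sumr -big_split; apply: eq_bigr => k _ /=.
have -> : (a + b + c = (i + j + k) + (a - i + (b - j) + (c - k)))%N.
  by have := ltn_ord i; have := ltn_ord j; have := ltn_ord k; lia.
by rewrite [in LHS]natrD; ring.
Qed.

Lemma eulerX F k : euler (F ^+ k) = euler F * F ^+ k.-1 *+ k.
Proof.
elim: k => [|k IH]; first by rewrite expr0 euler1 mulr0n.
rewrite exprS eulerM IH; case: k {IH} => [|k]; first by rewrite !expr0; ring.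
by rewrite /= mulrnAr mulrCA -exprS -mulrS.
Qed.

Lemma vanish_euler F : vanish 1 (euler F).
Proof.
by move=> a b c; rewrite ltnS leqn0 /euler => /eqP ->; rewrite mul0r.
Qed.

(** The logarithmic derivative turns products into sums and determines
    [fs_neglog] up to the division by the height. *)
Definition dneglog F := - euler F * fsinv F.

Lemma dneglogE F a b c : unital F ->
  (a + b + c)%:R * fs_neglog F a b c = dneglog F a b c.
Proof.
move=> uF; set n := (a + b + c)%N; rewrite /fs_neglog mulr_sumr.
(* The first [n] terms of the geometric series give accuracy [n.+1], because the factor [euler F]
   has no constant term. What is left is the termwise derivative of the series defining
   [fs_neglog]. *)
have v : vanish n.+1 (dneglog F - \sum_(k < n) euler (1 - F) * (1 - F) ^+ k).
  rewrite -mulr_sumr /dneglog eulerD euler1 add0r eulerN -mulrBr -add1n.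
  by apply: vanishM; [apply/vanishN/vanish_euler|apply: fsinv_geom].
have /eqP := v a b c (ltnSn n); rewrite fsB subr_eq0 => /eqP ->.
rewrite fs_sumE -(big_mkord xpredT (fun k => (euler (1 - F) * (1 - F) ^+ k) a b c)).
rewrite big_add1 /=; apply: eq_bigr => k _.
rewrite -[fs_mul _ _]/(fs_exp (fs_sub fs_one F) k.+1).
have -> : fs_exp (fs_sub fs_one F) k.+1 = (1 - F) ^+ k.+1.
  by rewrite -fs_expE -fs_oneE.
have k0 : k.+1%:R != 0 :> rat by rewrite pnatr_eq0.
rewrite mulrA -[_%:R * _]/(euler ((1 - F) ^+ k.+1) a b c) eulerX fsMn /=.
by rewrite -[X in X / _]mulr_natr mulfK.
Qed.

Lemma dneglogM F G : unital F -> unital G ->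
  dneglog (F * G) = dneglog F + dneglog G.
Proof.
move=> uF uG; rewrite /dneglog eulerM fsinvM //.
have eF := mulr_fsinv uF; have eG := mulr_fsinv uG.
transitivity (- euler F * fsinv F * (G * fsinv G) + - euler G * fsinv G * (F * fsinv F)).
  by ring.
by rewrite eF eG !mulr1.
Qed.

Definition nonneg_upto N F := forall a b c, (a + b + c <= N)%N -> 0 <= F a b c.

Lemma nonneg_uptoD N F G : nonneg_upto N F -> nonneg_upto N G -> nonneg_upto N (F + G).
Proof. by move=> nF nG a b c le; rewrite fsD addr_ge0 ?nF ?nG. Qed.

Lemma nonneg_uptoM N F G : nonneg_upto N F -> nonneg_upto N G -> nonneg_upto N (F * G).
Proof.
move=> nF nG a b c le; rewrite fsM; apply: sumr_ge0 => i _; apply: sumr_ge0 => j _.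
apply: sumr_ge0 => k _; have := ltn_ord i; have := ltn_ord j; have := ltn_ord k.
by move=> *; apply: mulr_ge0; [apply: nF|apply: nG]; lia.
Qed.

Lemma nonneg_upto1 N : nonneg_upto N 1.
Proof. by move=> a b c _; rewrite fs1 ler0n. Qed.

Lemma nonneg_uptoX N F k : nonneg_upto N F -> nonneg_upto N (F ^+ k).
Proof.
move=> nF; elim: k => [|k IH]; first by rewrite expr0; apply: nonneg_upto1.
by rewrite exprS; apply: nonneg_uptoM.
Qed.

Lemma nonneg_upto_euler N F : nonneg_upto N F -> nonneg_upto N (euler F).
Proof. by move=> nF a b c le; rewrite mulr_ge0 ?nF. Qed.

Lemma nonneg_upto_fsinv N F : nonneg_upto N F -> nonneg_upto N (fsinv (1 - F)).
Proof.
move=> nF a b c le; apply: sumr_ge0 => k _.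
have -> : 1 - (1 - F) = F by ring.
exact: (nonneg_uptoX k nF).
Qed.

Lemma nonneg_upto_dneglog N F : nonneg_upto N F -> nonneg_upto N (dneglog (1 - F)).
Proof.
move=> nF; rewrite /dneglog eulerD euler1 add0r eulerN opprK.
by apply: nonneg_uptoM; [apply: nonneg_upto_euler|apply: nonneg_upto_fsinv].
Qed.

Definition mono (i j k : nat) : fs := fun a b c => ((a == i) && (b == j) && (c == k))%:R.

Lemma monoM i j k F a b c : (mono i j k * F) a b c =
  if (i <= a)%N && (j <= b)%N && (k <= c)%N then F (a - i)%N (b - j)%N (c - k)%N else 0.
Proof.
rewrite fsM /fs_mul /mono.
case: ifPn => [/andP[/andP[ia jb] kc]|nle].
  rewrite (bigD1 (Ordinal (ia : (i < a.+1)%N))) //= (bigD1 (Ordinal (jb : (j < b.+1)%N))) //=.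
  rewrite (bigD1 (Ordinal (kc : (k < c.+1)%N))) //= !eqxx mul1r.
  rewrite !big1 ?addr0 // => x /eqP nx.
  - apply: big1 => y _; apply: big1 => z _; case: eqP => [e|_]; last by rewrite mul0r.
    by case: nx; apply: val_inj.
  - apply: big1 => y _; case: (@eqP _ (nat_of_ord x) j) => [e|_]; last by rewrite mul0r.
    by case: nx; apply: val_inj.
  - case: (@eqP _ (nat_of_ord x) k) => [e|_]; last by rewrite mul0r.
    by case: nx; apply: val_inj.
apply: big1 => x _; apply: big1 => y _; apply: big1 => z _.
case: andP => [[/andP[/eqP ex /eqP ey] /eqP ez]|_]; last by rewrite mul0r.
by move: nle; rewrite -ex -ey -ez; have := ltn_ord x; have := ltn_ord y; have := ltn_ord z; lia.
Qed.

Lemma nonneg_upto_mono N i j k : nonneg_upto N (mono i j k).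
Proof. by move=> a b c _; rewrite ler0n. Qed.

Lemma vanish_mono i j k : (0 < i + j + k)%N -> vanish 1 (mono i j k).
Proof.
move=> pos a b c; rewrite ltnS leqn0 => /eqP h; rewrite /mono.
by case: andP => // -[/andP[/eqP ea /eqP eb] /eqP ec]; lia.
Qed.

(** For [G] the generating series of the dimensions, the last condition says that
    [- log F] dominates [G] up to height [N]. *)
Definition log_bound N F G :=
  [/\ unital F, nonneg_upto N (fsinv F) & nonneg_upto N (dneglog F - euler G)].

Lemma log_bound_step N i j k F F' G' : (0 < i + j + k)%N -> unital F ->
  log_bound N F' G' -> nonneg_upto N ((1 - mono i j k) * F' - F) ->
  log_bound N F (mono i j k + G').
Proof.
move=> ijk uF [uF' iF' lF'] nR.
set M := mono i j k in nR *; set Rr := (X in nonneg_upto N X) in nR.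
have uM : unital (1 - M) by apply/vanish_unital/vanish_mono.
have nM : nonneg_upto N M by apply: nonneg_upto_mono.
have eM := mulr_fsinv uM; have eF' := mulr_fsinv uF'.
pose Y := Rr * (fsinv F' * fsinv (1 - M)).
have nY : nonneg_upto N Y.
  by apply: nonneg_uptoM => //; apply: nonneg_uptoM => //; apply: nonneg_upto_fsinv.
have FY : F = (1 - M) * (F' * (1 - Y)).
  have -> : (1 - M) * (F' * (1 - Y)) =
      (1 - M) * F' - Rr * ((F' * fsinv F') * ((1 - M) * fsinv (1 - M))).
    by rewrite /Y; ring.
  by rewrite eM eF' !mulr1 /Rr; ring.
(* [Rr] is a difference of two series with constant term 1, so [Y] has none. *)
have uY : unital (1 - Y).
  apply: vanish_unital; rewrite -[1%N]addn0; apply: vanishM => //.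
  have -> : Rr = (1 - F) - (1 - (1 - M) * F') by rewrite /Rr; ring.
  by apply/vanishD/vanishN/unital_vanish/unitalM => //; apply: unital_vanish.
have uFY := unitalM uF' uY.
split=> //; first rewrite FY !fsinvM //.
  by do ?[apply: nonneg_uptoM => //]; apply: nonneg_upto_fsinv.
have -> : dneglog F - euler (M + G') =
    (dneglog (1 - M) - euler M) + (dneglog F' - euler G') + dneglog (1 - Y).
  by rewrite [in LHS]FY !dneglogM // eulerD; ring.
apply/nonneg_uptoD/nonneg_upto_dneglog => //; apply: nonneg_uptoD => //.
(* This is the Euler derivative of the sum of [M ^+ k / k] over [k >= 2], what remains of the
   logarithm of [1 - M] once its linear term has paid for the removed basis vector. *)
have -> : dneglog (1 - M) - euler M = euler M * (M * fsinv (1 - M)).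
  transitivity (euler M * fsinv (1 - M) - euler M * ((1 - M) * fsinv (1 - M))).
    by rewrite eM mulr1 /dneglog eulerD euler1 eulerN add0r opprK.
  by ring.
do ?[apply: nonneg_uptoM => //]; first exact: nonneg_upto_euler.
exact: nonneg_upto_fsinv.
Qed.

(** The end of the induction, when no basis vector is left in heights up to [N]. *)
Lemma log_bound_vanish N F G : vanish N.+1 (F - 1) -> vanish N.+1 G -> log_bound N F G.
Proof.
move=> vF vG; have uF : unital F.
  by have := vF 0%N 0%N 0%N isT; rewrite fsB fs1 => /eqP; rewrite subr_eq0 => /eqP.
have iF : vanish N.+1 (fsinv F - 1).
  have -> : fsinv F - 1 = - ((F - 1) * fsinv F).
    by rewrite mulrBl mulr_fsinv //; ring.
  by apply: vanishN; rewrite -[N.+1]addn0; apply: vanishM.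
have vE H : vanish N.+1 H -> vanish N.+1 (euler H).
  by move=> vH a b c lt; rewrite /euler vH ?mulr0.
split=> // a b c le.
  by rewrite -[fsinv F](subrK 1) fsD iF // add0r fs1.
have -> // : (dneglog F - euler G) a b c = 0; apply: (_ : vanish N.+1 _) le.
apply/vanishD/vanishN/vE => //; rewrite -[N.+1]addn0; apply: vanishM => //.
rewrite -[F](subrK 1) eulerD euler1 addr0.
by apply/vanishN/vE.
Qed.

End Series.

(** * Operators on the exterior algebra *)

Section ExteriorOperators.
Variables (K : fieldType) (L : lieType K).

Lemma ext_ind n (P : set (ext L n)) : subspace P -> (forall x, P (wedge x)) ->
  forall w, P w.
Proof.
move=> sP Pw w; rewrite -[w]mqpi_repr -(freeg_sumE (repr w)).
rewrite linear_sum; apply: (big_ind P) => [|u v|x _]; [by case: sP|exact: subspaceD|].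
have -> : << coeff x (repr w) *g x >> = coeff x (repr w) *: tensor x.
  by apply/eqP/freeg_eqP => y; rewrite coeffZ !coeffU mul1r.
rewrite linearZ; apply: subspaceZ => //; exact: Pw.
Qed.

Lemma ext_eq n (V : lmodType K) (F G : {linear ext L n -> V}) :
  (forall x, F (wedge x) = G (wedge x)) -> forall w, F w = G w.
Proof.
move=> FG; apply: ext_ind => //; split; first by rewrite !linear0.
by move=> a x y /= Fx Fy; rewrite !linearP Fx Fy.
Qed.

Definition multilinear n (V : lmodType K) (f : {ffun 'I_n -> L} -> V) :=
  forall x i a u v, f (upd x i (a *: u + v)) = a *: f (upd x i u) + f (upd x i v).

Definition alternating n (V : lmodType K) (f : {ffun 'I_n -> L} -> V) :=
  forall (x : {ffun 'I_n -> L}) (i j : 'I_n), j = i.+1 :> nat -> x i = x j -> f x = 0.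

(** The universal property of the exterior power. Exterior multiplication, derivations and interior
    products are all obtained from it. *)
Lemma extlift n (V : lmodType K) (f : {ffun 'I_n -> L} -> V) :
  multilinear f -> alternating f ->
  {F : {linear ext L n -> V} | forall x, F (wedge x) = f x}.
Proof.
move=> fl fa.
pose g : chain L n -> V := fglift f.
have glin : linear g by move=> a x y; apply: fglift_linear.
have g0 : g 0 = 0 by have := glin (-1) 0 0; rewrite scaler0 addr0 scaleN1r addNr.
have gtens x : g (tensor x) = f x by rewrite /g /tensor liftU scale1r.
have grel D : D \in lspan (@ext_rel K L n) -> g D = 0.
  move=> /lspanP; elim=> // a r s rr _ IH; rewrite glin IH addr0.
  suff -> : g r = 0 by rewrite scaler0.
  case: rr => [x i b u v|x i j ij xij]; last by rewrite gtens (fa _ i j).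
  rewrite -scaleN1r addrC !glin !gtens fl.
  by rewrite scaleN1r addNr.
pose F (w : ext L n) := g (repr w).
have FD D : F (mqpi _ D) = g D.
  rewrite /F; set E := repr _.
  have ED : E - D \in lspan (@ext_rel K L n) by rewrite -mqpi_eq mqpi_repr.
  by rewrite -[E](subrK D) -[_ - _]scale1r glin grel // scaler0 add0r.
have Flin : linear F.
  move=> a x y; rewrite -[x in LHS]mqpi_repr -[y in LHS]mqpi_repr -mqpi_linear FD.
  exact: glin.
pose F' : {linear ext L n -> V} := HB.pack F (GRing.isLinear.Build K _ V _ F Flin).
exists F' => x.
by rewrite /= /wedge FD.
Qed.


(** * Exterior multiplication by a vector *)

Definition fcons n (y : L) (x : {ffun 'I_n -> L}) : {ffun 'I_n.+1 -> L} :=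
  [ffun k => if unlift ord0 k is Some j then x j else y].

Lemma fcons0 n y (x : {ffun 'I_n -> L}) : fcons y x ord0 = y.
Proof. by rewrite ffunE unlift_none. Qed.

Lemma fconsS n y (x : {ffun 'I_n -> L}) j : fcons y x (lift ord0 j) = x j.
Proof. by rewrite ffunE liftK. Qed.

Lemma fcons_eta n (x : {ffun 'I_n.+1 -> L}) :
  x = fcons (x ord0) [ffun j => x (lift ord0 j)].
Proof.
by apply/ffunP => k; case: (unliftP ord0 k) => [j|] ->; rewrite ?fcons0 // fconsS ffunE.
Qed.

Lemma upd_fcons0 n y (x : {ffun 'I_n -> L}) u : upd (fcons y x) ord0 u = fcons u x.
Proof.
apply/ffunP => k; rewrite ffunE; case: (unliftP ord0 k) => [j|] ->.
  by rewrite eq_sym (negbTE (neq_lift _ _)) !fconsS.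
by rewrite eqxx fcons0.
Qed.

Lemma upd_fconsS n y (x : {ffun 'I_n -> L}) i u :
  upd (fcons y x) (lift ord0 i) u = fcons y (upd x i u).
Proof.
apply/ffunP => k; rewrite ffunE; case: (unliftP ord0 k) => [j|] ->.
  by rewrite (inj_eq lift_inj) !fconsS ffunE.
by rewrite (negbTE (neq_lift _ _)) !fcons0.
Qed.

Lemma wcons_multilinear n (y : L) : multilinear (fun x : {ffun 'I_n -> L} => wedge (fcons y x)).
Proof. by move=> x i a u v; rewrite -!upd_fconsS wedge_lin. Qed.

Lemma wcons_alternating n (y : L) : alternating (fun x : {ffun 'I_n -> L} => wedge (fcons y x)).
Proof.
move=> x i j ij xij; apply: (@wedge_alt _ _ _ _ (lift ord0 i) (lift ord0 j)).
  by rewrite !lift0 ij.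
by rewrite !fconsS.
Qed.

Definition wcons n (y : L) : {linear ext L n -> ext L n.+1} :=
  sval (extlift (@wcons_multilinear n y) (@wcons_alternating n y)).

Lemma wcons_wedge n y (x : {ffun 'I_n -> L}) : wcons n y (wedge x) = wedge (fcons y x).
Proof. exact: (svalP (extlift _ _)). Qed.

Lemma wcons_linear n (w : ext L n) : linear (fun y => wcons n y w).
Proof.
move=> a u v; move: w; apply: (ext_eq
  (F := wcons n (a *: u + v)) (G := a \*: wcons n u \+ wcons n v)) => x /=.
rewrite !wcons_wedge -(upd_fcons0 0 x (a *: u + v)) wedge_lin.
by rewrite !upd_fcons0.
Qed.

Lemma wcons_lin n (w : ext L n) a u v :
  wcons n (a *: u + v) w = a *: wcons n u w + wcons n v w.
Proof. exact: (wcons_linear w). Qed.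

Lemma wconsD n (w : ext L n) u v : wcons n (u + v) w = wcons n u w + wcons n v w.
Proof. by rewrite -[u]scale1r wcons_lin !scale1r. Qed.

Lemma wcons0 n (w : ext L n) : wcons n 0 w = 0.
Proof. by apply: (addrI (wcons n 0 w)); rewrite -wconsD !addr0. Qed.

Lemma wconsZ n (w : ext L n) a u : wcons n (a *: u) w = a *: wcons n u w.
Proof. by rewrite -[a *: u]addr0 wcons_lin wcons0 addr0. Qed.

Lemma wconsxx n y (w : ext L n) : wcons _ y (wcons _ y w) = 0.
Proof.
move: w; apply: (ext_eq (F := wcons _ y \o wcons _ y) (G := \0)) => x /=.
rewrite !wcons_wedge; apply: (@wedge_alt _ _ _ _ ord0 (lift ord0 ord0)) => //.
by rewrite fconsS !fcons0.
Qed.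

Lemma wconsC n x y (w : ext L n) : wcons _ x (wcons _ y w) = - wcons _ y (wcons _ x w).
Proof.
have := wconsxx (x + y) w; rewrite wconsD !wconsD !linearD /= !wconsxx add0r addr0.
by move=> /eqP; rewrite addr_eq0 => /eqP.
Qed.

Lemma ext_wcons_eq n (V : lmodType K) (F G : {linear ext L n.+1 -> V}) :
  (forall y w, F (wcons n y w) = G (wcons n y w)) -> forall w, F w = G w.
Proof.
by move=> FG; apply: ext_eq => x; rewrite [x]fcons_eta -wcons_wedge.
Qed.

(** Moving [y] from the front into slot [k] costs [k] transpositions. This reconciles [contract],
    which puts the bracket in a slot, with formulas that put it in front. *)
Lemma wedge_move n y k (x : {ffun 'I_n.+1 -> L}) :
  wedge (fcons y [ffun j => x (lift k j)]) = (-1) ^+ k *: wedge (upd x k y).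
Proof.
elim: n k x => [|n IH] k x; case: (unliftP ord0 k) => [k'|] ->.
- by case: k'.
- by rewrite {2}[x]fcons_eta upd_fcons0 scale1r.
- rewrite {2}[x]fcons_eta upd_fconsS lift0 exprS mulN1r scaleNr.
  set z := [ffun j => x (lift ord0 j)].
  have <- : wcons _ (x ord0) ((-1) ^+ k' *: wedge (upd z k' y)) =
      (-1) ^+ k' *: wedge (fcons (x ord0) (upd z k' y)).
    by rewrite linearZ /= wcons_wedge.
  rewrite -IH.
  have -> : [ffun j => x (lift (lift ord0 k') j)] =
      fcons (x ord0) [ffun j => z (lift k' j)]; last by rewrite -!wcons_wedge wconsC.
  rewrite [LHS]fcons_eta; congr fcons.
    by rewrite ffunE; congr (x _); apply/val_inj.
  by apply/ffunP => j; rewrite !ffunE; congr (x _); apply/val_inj; rewrite /= /bump /=; lia.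
- by rewrite {2}[x]fcons_eta upd_fcons0 scale1r.
Qed.

(** * Extension of an endomorphism to a derivation of the exterior algebra *)

Section Derivation.
Variable D : {linear L -> L}.

Definition der_tensor n (x : {ffun 'I_n -> L}) : ext L n :=
  \sum_k wedge (upd x k (D (x k))).

Lemma updC n (x : {ffun 'I_n -> L}) i j u v : i != j ->
  upd (upd x i u) j v = upd (upd x j v) i u.
Proof.
by move=> ij; apply/ffunP => k; rewrite !ffunE; case: (k =P i) => // ->; rewrite (negbTE ij).
Qed.

Lemma upd_upd n (x : {ffun 'I_n -> L}) i u v : upd (upd x i u) i v = upd x i v.
Proof. by apply/ffunP => k; rewrite !ffunE; case: eqP. Qed.

Lemma updE n (x : {ffun 'I_n -> L}) i u : upd x i u i = u.
Proof. by rewrite ffunE eqxx. Qed.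

Lemma updN n (x : {ffun 'I_n -> L}) i k u : k != i -> upd x i u k = x k.
Proof. by move=> ki; rewrite ffunE (negbTE ki). Qed.

Lemma der_multilinear n : multilinear (@der_tensor n).
Proof.
move=> x i a u v; rewrite /der_tensor scaler_sumr -big_split; apply: eq_bigr => k _ /=.
have [->|ki] := eqVneq k i; first by rewrite !updE !upd_upd linearP wedge_lin.
by rewrite !updN // !(updC _ _ _ (_ : i != k)) 1?eq_sym // wedge_lin.
Qed.

Lemma der_alternating n : alternating (@der_tensor n).
Proof.
move=> x i j ij xij; rewrite /der_tensor.
have nij : j != i by apply/eqP => e; move: ij; rewrite e; apply/n_Sn.
rewrite (bigD1 i) //= (bigD1 j) //= big1 ?addr0 => [|k /andP[ki kj]]; last first.
  by apply: (@wedge_alt _ _ _ _ i j) => //; rewrite !updN // eq_sym.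
(* Only the terms [k = i] and [k = j] survive; as [x i = x j], they differ by a swap of adjacent
   slots and cancel. *)
have e u : upd x i u = upd (upd x i u) j (x i).
  by rewrite xij -(updN x u nij) upd_id.
rewrite [in X in X + _]e wedge_swap // upd_id -xij.
by rewrite addNr.
Qed.

Definition der n : {linear ext L n -> ext L n} :=
  sval (extlift (@der_multilinear n) (@der_alternating n)).

Lemma der_wedge n (x : {ffun 'I_n -> L}) : der n (wedge x) = der_tensor x.
Proof. exact: (svalP (extlift _ _)). Qed.

Lemma der_ext0 (w : ext L 0) : der 0 w = 0.
Proof.
by move: w; apply: (ext_eq (G := \0)) => x; rewrite der_wedge /der_tensor big_ord0.
Qed.

Lemma der_wcons n y (w : ext L n) :
  der n.+1 (wcons n y w) = wcons n (D y) w + wcons n y (der n w).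
Proof.
move: w; apply: (ext_eq (F := der n.+1 \o wcons n y)
  (G := wcons n (D y) \+ (wcons n y \o der n))) => x /=.
rewrite !wcons_wedge !der_wedge /der_tensor big_ord_recl linear_sum; congr (_ + _).
  by rewrite fcons0 upd_fcons0.
by apply: eq_bigr => k _; rewrite fconsS upd_fconsS wcons_wedge.
Qed.

End Derivation.

(** * Interior product with a linear functional *)

Section Contraction.
Variable phi : {linear L -> K^o}.

Definition omit n (x : {ffun 'I_n.+1 -> L}) (k : 'I_n.+1) : {ffun 'I_n -> L} :=
  [ffun j => x (lift k j)].

Definition iota_tensor n (x : {ffun 'I_n.+1 -> L}) : ext L n :=
  \sum_(k < n.+1) ((-1) ^+ k * phi (x k) : K) *: wedge (omit x k).

Lemma omit_upd n (x : {ffun 'I_n.+1 -> L}) k u : omit (upd x k u) k = omit x k.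
Proof. by apply/ffunP => j; rewrite !ffunE eq_sym (negbTE (neq_lift _ _)). Qed.

Lemma omit_upd_lift n (x : {ffun 'I_n.+1 -> L}) k i u :
  omit (upd x (lift k i) u) k = upd (omit x k) i u.
Proof. by apply/ffunP => j; rewrite !ffunE (inj_eq lift_inj). Qed.

Lemma iota_multilinear n : multilinear (@iota_tensor n).
Proof.
move=> x i a u v; rewrite /iota_tensor scaler_sumr -big_split; apply: eq_bigr => k _ /=.
case: (unliftP k i) => [j|] ->.
  rewrite !omit_upd_lift wedge_lin !updN ?neq_lift // scalerDr; congr (_ + _).
  by rewrite !scalerA mulrC.
rewrite !omit_upd !updE linearP /= mulrDr scalerDl; congr (_ + _).
by rewrite scalerA mulrCA.
Qed.

Lemma iota_alternating n : alternating (@iota_tensor n).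
Proof.
move=> x i j ij xij; rewrite /iota_tensor.
have nij : j != i by apply/eqP => e; move: ij; rewrite e; apply/n_Sn.
rewrite (bigD1 i) //= (bigD1 j) //= big1 ?addr0 => [|k /andP[ki kj]]; last first.
  case: (unliftP k i) => [i' ei|e]; last by rewrite e eqxx in ki.
  case: (unliftP k j) => [j' ej|e]; last by rewrite e eqxx in kj.
  rewrite (@wedge_alt _ _ _ _ i' j') ?scaler0 //; last by rewrite !ffunE -ei -ej.
  move: ij ki kj; rewrite -!val_eqE ei ej /= /bump.
  by case: leqP; case: leqP; lia.
have -> : omit x j = omit x i.
  apply/ffunP => k; rewrite !ffunE.
  have [ki|ki] := eqVneq (k : nat) i.
    have -> : lift i k = j by apply/val_inj; rewrite /= /bump ij ki leqnn.
    have -> : lift j k = i by apply/val_inj; rewrite /= /bump ij ki ltnn.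
    by [].
  congr (x _); apply/val_inj; rewrite /= /bump ij.
  by congr (_ + _)%N; rewrite ltn_neqAle eq_sym ki.
by rewrite -scalerDl -xij -mulrDl ij exprS mulN1r addrN mul0r scale0r.
Qed.

Definition iota_ext n : {linear ext L n.+1 -> ext L n} :=
  sval (extlift (@iota_multilinear n) (@iota_alternating n)).

Lemma iota_wedge n (x : {ffun 'I_n.+1 -> L}) : iota_ext n (wedge x) = iota_tensor x.
Proof. exact: (svalP (extlift _ _)). Qed.

Lemma omit_fcons0 n y (x : {ffun 'I_n -> L}) : omit (fcons y x) ord0 = x.
Proof. by apply/ffunP => j; rewrite ffunE fconsS. Qed.

Lemma omit_fconsS n y (x : {ffun 'I_n.+1 -> L}) k :
  omit (fcons y x) (lift ord0 k) = fcons y (omit x k).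
Proof.
apply/ffunP => j; case: (unliftP ord0 j) => [j'|] ->; rewrite ffunE.
  have -> : lift (lift ord0 k) (lift ord0 j') = lift ord0 (lift k j').
    by apply/val_inj; rewrite /= /bump /=; lia.
  by rewrite !fconsS ffunE.
have -> : lift (lift ord0 k) ord0 = ord0 by apply/val_inj.
by rewrite !fcons0.
Qed.

Lemma iota_wcons0 y (w : ext L 0) : iota_ext 0 (wcons 0 y w) = (phi y : K) *: w.
Proof.
move: w; apply: (ext_eq (F := iota_ext 0 \o wcons 0 y) (G := (phi y : K) \*: idfun)) => x /=.
by rewrite wcons_wedge iota_wedge /iota_tensor big_ord1 fcons0 omit_fcons0 mul1r.
Qed.

Lemma iota_wcons n y (w : ext L n.+1) :
  iota_ext n.+1 (wcons n.+1 y w) = (phi y : K) *: w - wcons n y (iota_ext n w).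
Proof.
move: w; apply: (ext_eq (F := iota_ext n.+1 \o wcons n.+1 y)
  (G := (phi y : K) \*: idfun \- (wcons n y \o iota_ext n))) => x /=.
rewrite wcons_wedge !iota_wedge /iota_tensor big_ord_recl fcons0 omit_fcons0 mul1r.
congr (_ + _); rewrite linear_sum -sumrN; apply: eq_bigr => k _.
rewrite fconsS omit_fconsS lift0 linearZ wcons_wedge exprS mulN1r mulNr scaleNr.
by [].
Qed.

End Contraction.

(** * Cartan's formula and its consequences for the boundary *)

HB.instance Definition _ (y : L) :=
  GRing.isLinear.Build K L L *:%R (lie y) (fun a u v => lie_linearr a u v y).

Definition ad (y : L) : {linear L -> L} := lie y.

Lemma bd_wcons0 y (w : ext L 0) : bd (wcons 0 y w) = 0.
Proof.
move: w; apply: (ext_eq (F := @bd K L 0 \o wcons 0 y) (G := \0)) => x /=.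
by rewrite wcons_wedge bd_wedge /bd_tensor; apply: big1 => q _; rewrite big1 // => -[].
Qed.

Lemma contract_fcons0 n y (x : {ffun 'I_n.+1 -> L}) q :
  contract (fcons y x) (lift ord0 q) ord0 = fcons (lie y (x q)) (omit x q).
Proof.
apply/ffunP => k; rewrite ffunE; case: (unliftP ord0 k) => [k'|] ->.
  rewrite eq_sym (negbTE (neq_lift _ _)) fconsS [omit _ _ _]ffunE -[RHS](fconsS y).
  by congr (fcons y x _); apply/val_inj; rewrite /= /bump /=; lia.
rewrite eqxx fcons0 fconsS; congr (lie _ _).
by rewrite -[RHS](fcons0 y x); congr (fcons y x _); apply/val_inj.
Qed.

Lemma contract_fconsS n y (x : {ffun 'I_n.+1 -> L}) q p :
  contract (fcons y x) (lift ord0 q) (lift ord0 p) = fcons y (contract x q p).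
Proof.
have e j : lift (lift ord0 q) (lift ord0 j) = lift ord0 (lift q j).
  by apply/val_inj; rewrite /= /bump /=; lia.
apply/ffunP => k; rewrite ffunE; case: (unliftP ord0 k) => [k'|] ->.
  by rewrite (inj_eq lift_inj) !e !fconsS ffunE.
rewrite (negbTE (neq_lift _ _)) fcons0 -[RHS](fcons0 y x).
by congr (fcons y x _); apply/val_inj.
Qed.

(** Cartan's formula: the pairs that involve slot 0 produce the Lie derivative along [y], the other
    pairs produce the boundary of [w] with its sign shifted. From here on [bd] is handled through
    this recursion instead of its signed double sum. *)
Lemma bd_wcons n y (w : ext L n.+1) :
  bd (wcons n.+1 y w) = - der (ad y) n.+1 w - wcons n y (bd w).
Proof.
move: w; apply: (ext_eq (F := @bd K L n.+1 \o wcons n.+1 y)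
  (G := \- der (ad y) n.+1 \- (wcons n y \o @bd K L n))) => x /=.
rewrite wcons_wedge !bd_wedge der_wedge /bd_tensor /der_tensor big_ord_recl.
rewrite big1 ?add0r => [|p]; last by rewrite ltn0.
rewrite [wcons n y _]linear_sum -!sumrN -big_split; apply: eq_bigr => q _ /=.
rewrite big_mkcond big_ord_recl /= contract_fcons0; congr (_ + _).
  (* The sign [(-1) ^+ q.+1] of the pair meets [(-1) ^+ q] from moving the bracket into slot [q], so
     [-1] is left for every [q]. *)
  rewrite wedge_move [bump _ _]add1n scalerA -exprD addSn exprS mulN1r scaleNr.
  by rewrite addnn -signr_odd odd_double scale1r.
rewrite -big_mkcond [wcons n y _]linear_sum -sumrN; apply: eq_big => [p|p _] /=.
  by rewrite /bump !add1n.
by rewrite contract_fconsS [bump _ _]add1n linearZ /= wcons_wedge exprS mulN1r scaleNr.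
Qed.

(** On a single factor this is the Jacobi identity; the recursion of [der] along [wcons] spreads it
    over all factors. *)
Lemma der_adC n x y (w : ext L n) :
  der (ad x) n (der (ad y) n w) =
  der (ad (lie x y)) n w + der (ad y) n (der (ad x) n w).
Proof.
elim: n w => [|n IH] w; first by rewrite !der_ext0 addr0.
move: w; apply: (ext_wcons_eq (F := der (ad x) n.+1 \o der (ad y) n.+1)
  (G := der (ad (lie x y)) n.+1 \+ (der (ad y) n.+1 \o der (ad x) n.+1))) => z w /=.
rewrite !der_wcons !linearD /= !der_wcons IH linearD /= /ad.
have -> : lie x (lie y z) = lie (lie x y) z + lie y (lie x z).
  have := lie_jacobi x y z; rewrite (lieC x z) lieNr (lieC (lie x y) z) => /eqP.
  by rewrite -addrA -opprD subr_eq0 addrC => /eqP.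
rewrite wconsD; set A := wcons n _ _; set B := wcons n _ _.
set C := wcons n _ _; set E := wcons n _ _; set F := wcons n _ _; set G := wcons n _ _.
by rewrite !addrA [LHS](ACl (1*5*2*4*3*6))/=.
Qed.

Lemma der_bd n x (w : ext L n.+1) : der (ad x) n (bd w) = bd (der (ad x) n.+1 w).
Proof.
elim: n w => [|n IH] w; move: w; apply: (ext_wcons_eq
  (F := der (ad x) _ \o @bd K L _) (G := @bd K L _ \o der (ad x) _)) => z w /=.
  by rewrite der_ext0 der_wcons der_ext0 linear0 addr0 bd_wcons0.
rewrite bd_wcons der_wcons linearB linearN linearD /= !bd_wcons der_wcons -IH.
rewrite (der_adC x z) !opprD.
by rewrite !addrA [RHS](ACl (1*3*2*4))/=.
Qed.

(** Applying Cartan's formula twice to [z] wedge [w] leaves the commutator of [bd] with the Lie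
    derivative along [z], which is 0 by [der_bd], and [z] wedge [bd (bd w)], which is 0 by
    induction. *)
Lemma bd_bd n (w : ext L n.+2) : bd (bd w) = 0.
Proof.
elim: n w => [|n IH] w; move: w; apply: (ext_wcons_eq
  (F := @bd K L _ \o @bd K L _) (G := \0)) => z w /=.
  rewrite bd_wcons linearB linearN /= bd_wcons0 subr0; move: w.
  apply: (ext_wcons_eq (F := \- (@bd K L 0 \o der (ad z) 1)) (G := \0)) => y w /=.
  by rewrite der_wcons der_ext0 linear0 addr0 bd_wcons0 oppr0.
by rewrite bd_wcons linearB linearN /= bd_wcons IH linear0 subr0 -der_bd opprK addNr.
Qed.

End ExteriorOperators.

(** * Linear functionals and weights *)

Section LinearFunctional.
Variables (K : fieldType) (V : lmodType K).

(** A maximal subspace [M] that contains [W] and misses [x] is a hyperplane complementary to [x],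
    and [phi] reads off the coefficient of [x] modulo [M]. *)
Lemma functional_separating (W : set V) x : subspace W -> ~ W x ->
  exists phi : {linear V -> K^o}, phi x = 1 /\ forall y, W y -> phi y = 0.
Proof.
move=> sW Wx.
(* Zorn's lemma runs over [A], but the condition is on its union with [W]: then the empty chain is
   also admissible, its union giving [W] itself. *)
pose P (A : set V) := subspace (W `|` A) /\ ~ (W `|` A) x.
have [|A [[sM Mx] maxA]] := @Zorn_bigcup _ P.
  move=> F FP tot; split; last first.
    by case=> // -[A FA Ax]; have [_] := FP _ FA; apply; right.
  split=> [|a u v]; first by left; case: sW.
  have sA A : F A -> subspace (W `|` A) by move=> /FP[].
  have inc A y : F A -> (W `|` A) y -> (W `|` \bigcup_(X in F) X) y.
    by move=> FA [Wy|Ay]; [left|right; exists A].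
  case=> [Wu|[A FA Au]] [Wv|[B FB Bv]].
  - by left; case: sW => _; apply.
  - by apply: (inc B) => //; apply: (sA B FB).2; [left|right].
  - by apply: (inc A) => //; apply: (sA A FA).2; [right|left].
  - have [AB|BA] := tot _ _ FA FB.
      by apply: (inc B) => //; apply: (sA B FB).2; right=> //; apply: AB.
    by apply: (inc A) => //; apply: (sA A FA).2; right=> //; apply: BA.
set M := W `|` A in sM Mx maxA.
(* If [y] is not in [M], then [M] enlarged by [y] contains [x] by maximality, and the resulting
   relation can be solved for [y], its coefficient being nonzero. *)
have ex y : exists c : K^o, M (y - c *: x).
  have [My|My] := EM (M y); first by exists 0; rewrite scale0r subr0.
  pose B : set V := [set z | exists c, M (z - c *: y)].
  have MB : M `<=` B by move=> z Mz; exists 0; rewrite scale0r subr0.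
  have WB : W `|` B = B by apply/setUidPr => z Wz; apply: MB; left.
  have sB : subspace B.
    split; first by apply: MB; case: sM.
    move=> a u v [c Mu] [c' Mv]; exists (a * c + c').
    have -> : a *: u + v - (a * c + c') *: y = a *: (u - c *: y) + (v - c' *: y).
      by rewrite scalerDl -scalerA opprD addrACA scalerBr.
    by case: sM => _; apply.
  have : ~ P B.
    apply: maxA; split=> [z Az|]; first by apply: MB; right.
    move=> BA; apply: My; right; apply: BA; exists 1.
    by rewrite scale1r subrr; case: sM.
  rewrite /P WB => nP; have [c Mc] : B x by apply: contrapT => nx; apply: nP.
  have c0 : c != 0 by apply/eqP => c0; apply: Mx; rewrite c0 scale0r subr0 in Mc.
  exists c^-1; have -> : y - c^-1 *: x = - c^-1 *: (x - c *: y).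
    by rewrite scalerBr !scaleNr scalerA mulVf // scale1r opprK addrC.
  exact: subspaceZ.
have [phi Mphi] := choice ex.
have uniq y c : M (y - c *: x) -> phi y = c.
  move=> My; have := subspaceD sM (subspaceN sM My) (Mphi y).
  rewrite opprB addrA subrK -scalerBl => Mc.
  apply/eqP; rewrite eq_sym -subr_eq0; apply/negPn/negP => nz.
  by apply: Mx; rewrite -[x]scale1r -(mulVf nz) -scalerA; apply: subspaceZ.
have phil : linear (phi : V -> K^o).
  move=> a u v; apply: uniq.
  have -> : a *: u + v - (a *: phi u + phi v) *: x = a *: (u - phi u *: x) + (v - phi v *: x).
    by rewrite scalerDl -scalerA opprD addrACA scalerBr.
  by case: sM => _; apply.
pose phi' : {linear V -> K^o} := HB.pack phi (GRing.isLinear.Build K V K^o _ phi phil).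
exists phi'; split=> [|y Wy]; apply: uniq.
  by rewrite scale1r subrr; case: sM.
by rewrite scale0r subr0; left.
Qed.

End LinearFunctional.

(** * Simultaneous eigenspaces for separated weights *)

Section Weights.
Variables (K : fieldType) (V : lmodType K) (I G : Type).
Variables (T : I -> {linear V -> V}) (chi : G -> I -> K).
Hypothesis chi_inj : forall a b, a <> b -> exists i, chi a i <> chi b i.

Definition weight_space a : set V := [set v | forall i, T i v = chi a i *: v].

Definition others (S : G -> set V) a : set V := [set x | exists2 b, b <> a & S b x].

Lemma weight_indep a v :
  weight_space a v -> v \in lspan (others weight_space a) -> v = 0.
Proof.
move=> va /lspanP ov.
(* [F] is a product of operators [(T i - chi b i) / (chi a i - chi b i)]. *)
suff [F [Fl Fv Fs Fa]] : exists F : V -> V, [/\ linear F, F v = 0,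
    forall b, exists k, forall x, weight_space b x -> F x = k *: x
    & forall x, weight_space a x -> F x = x] by rewrite -(Fa _ va).
elim: ov => {va v} [|c u v [b ba ub] _ [F [Fl Fv Fs Fa]]].
  exists id; split=> //; first by move=> b; exists 1 => x; rewrite scale1r.
have [i hi] := chi_inj ba.
have ci : chi a i - chi b i != 0 by rewrite subr_eq0; apply/eqP => e; apply: hi.
pose F' x := (chi a i - chi b i)^-1 *: (T i (F x) - chi b i *: F x).
have F'l : linear F'.
  move=> d x y; rewrite /F' Fl linearP /= [chi b i *: _]scalerDr opprD addrACA scalerDr.
  congr (_ + _); rewrite [chi b i *: _]scalerA [chi b i * d]mulrC -[(d * _) *: _]scalerA.
  by rewrite -scalerBr !scalerA [_ * d]mulrC.
have F's b' x k : weight_space b' x -> F x = k *: x ->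
    F' x = ((chi a i - chi b i)^-1 * (chi b' i - chi b i) * k) *: x.
  move=> xb Fx; rewrite /F' Fx linearZ /= xb scalerA [k * _]mulrC -!scalerA -scalerBl.
  by [].
exists F'; split=> //.
- have [k Fu] := Fs b; rewrite F'l (F's b u k) ?Fu // subrr mulr0 mul0r scale0r scaler0.
  by rewrite add0r /F' Fv linear0 scaler0 subrr scaler0.
- by move=> b'; have [k Fk] := Fs b'; eexists => x xb; apply: (F's b') => //; apply: Fk.
- by move=> x xa; rewrite (F's a x 1) ?scale1r ?Fa // mulr1 mulVf // scale1r.
Qed.

Lemma lspan_component (S : G -> set V) a x : (forall b, subspace (S b)) ->
  x \in lspan [set x | exists b, S b x] ->
  exists2 y, S a y & x - y \in lspan (others S a).
Proof.
move=> sS /lspanP; elim=> [|c u v [b Su] _ [y Sy vy]].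
  by exists 0; [case: (sS a)|rewrite subrr rpred0].
have [ba|ba] := EM (b = a).
  exists (c *: u + y); first by apply: (sS a).2 => //; rewrite -ba.
  by rewrite opprD addrACA subrr add0r.
exists y => //; rewrite -addrA rpredD // rpredZ //; apply: lspan_incl.
by exists b.
Qed.

(** If parts of the weight spaces already span, they exhaust them: the difference between [x] and
    its component lies in weight [a] and in the span of the other weights. Applied to bracket words,
    this describes root spaces. *)
Lemma weight_component (S : G -> set V) a x : (forall b, subspace (S b)) ->
  (forall b, S b `<=` weight_space b) ->
  x \in lspan [set x | exists b, S b x] -> weight_space a x -> S a x.
Proof.
move=> sS Sw xs xa; have [y Sy xy] := lspan_component a sS xs.
suff e : x - y = 0 by rewrite -[x](subrK y) e add0r.
apply: (@weight_indep a).
  move=> i; rewrite linearB /= xa (Sw _ _ Sy) scalerBr; exact: erefl.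
by apply: lspanS xy => z [b ba Sz]; exists b => //; apply: Sw.
Qed.

End Weights.

(** * Graded pieces of the exterior algebra *)

Notation piece V n a := (@ext_piece _ _ _ V n a).

Section ExteriorPieces.
Variables (K : fieldType) (L : lieType K) (G : zmodType).
Implicit Types V : G -> set L.

Lemma subspace_preimg (U W : lmodType K) (f : {linear U -> W}) (S : set W) :
  subspace S -> subspace [set x | S (f x)].
Proof.
by move=> [S0 SD]; split=> [|a x y /= Sx Sy]; rewrite /= ?linear0 // linearP; apply: SD.
Qed.

Lemma subspace_piece V n a : subspace (piece V n a).
Proof. exact: subspace_in_span. Qed.

Lemma piece_0 V n a : piece V n a 0.
Proof. by case: (subspace_piece V n a). Qed.

Lemma piece_lin V n a c u v : piece V n a u -> piece V n a v -> piece V n a (c *: u + v).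
Proof. by case: (subspace_piece V n a) => _; apply. Qed.

Lemma piece_wedge V n a (x : {ffun 'I_n -> L}) (b : 'I_n -> G) :
  (forall i, V (b i) (x i)) -> \sum_i b i = a -> piece V n a (wedge x).
Proof.
move=> Vx ba; rewrite -[wedge x]scale1r -[_ *: _]addr0; apply: in_spanD.
  by exists x, b.
exact: in_span0.
Qed.

Lemma piece_wcons V n b c y (w : ext L n) : V b y -> piece V n c w ->
  piece V n.+1 (b + c) (wcons n y w).
Proof.
move=> Vy; elim=> {w} [|a u v [x [d [Vx dc ->]]] _ IH].
  by rewrite linear0; apply: in_span0.
rewrite linearP /=; apply: (subspace_piece _ _ _).2 => //; rewrite wcons_wedge.
apply: (@piece_wedge _ _ _ _ (fun k => if unlift ord0 k is Some j then d j else b)).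
  by move=> i; case: (unliftP ord0 i) => [j|] ->; rewrite ?liftK ?unlift_none ?fcons0 // fconsS.
rewrite big_ord_recl unlift_none -dc; congr (_ + _).
by apply: eq_bigr => j _; rewrite liftK.
Qed.

(** Splitting off the first homogeneous factor is the induction used for nearly every statement on
    graded pieces. *)
Lemma piece_ind V n a (P : set (ext L n.+1)) : subspace P ->
  (forall b y w, V b y -> piece V n (a - b) w -> P (wcons n y w)) ->
  piece V n.+1 a `<=` P.
Proof.
move=> sP Pw w; elim=> {w} [|c u v [x [d [Vx dc ->]]] _ IH]; first by case: sP.
apply: sP.2 => //; rewrite [x]fcons_eta -wcons_wedge; apply: (Pw (d ord0)) => //.
apply: (@piece_wedge _ _ _ _ (fun j => d (lift ord0 j))) => [j|]; first by rewrite ffunE.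
by rewrite -dc big_ord_recl addrC addKr.
Qed.

Lemma piece0T V w : piece V 0 0 w.
Proof.
move: w; apply: ext_ind; first exact: subspace_piece.
by move=> x; apply: (@piece_wedge _ _ _ _ (fun=> 0)) => [[]|] //; rewrite big_ord0.
Qed.

Lemma piece0N V a w : a != 0 -> piece V 0 a w -> w = 0.
Proof.
move=> a0; elim=> // c u v [x [d [_ da _]]] _ _.
by move: a0; rewrite -da big_ord0 eqxx.
Qed.

Lemma piece0_eq V V' a : piece V 0 a = piece V' 0 a.
Proof.
have [->|a0] := eqVneq a 0; apply/seteqP; split=> w.
- by move=> _; apply: piece0T.
- by move=> _; apply: piece0T.
- by move=> /(piece0N a0) ->; apply: piece_0.
- by move=> /(piece0N a0) ->; apply: piece_0.
Qed.

Lemma pieceS V V' n a : (forall b, V b `<=` V' b) -> piece V n a `<=` piece V' n a.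
Proof.
move=> VV'; elim: n a => [|n IH] a; first by rewrite (piece0_eq V V').
apply: piece_ind => [|b y w Vy Vw]; first exact: subspace_piece.
by rewrite -[a](subrK b) addrC; apply: piece_wcons; [apply: VV'|apply: IH].
Qed.

Lemma piece_der V (D : {linear L -> L}) b0 n a w :
  (forall c y, V c y -> V (b0 + c) (D y)) ->
  piece V n a w -> piece V n (b0 + a) (der D n w).
Proof.
move=> VD; elim: n a w => [|n IH] a w.
  by rewrite der_ext0 => _; apply: piece_0.
move: w; apply: piece_ind => [|b y w Vy Vw].
  exact: (subspace_preimg (der D n.+1) (subspace_piece V n.+1 (b0 + a))).
rewrite /= der_wcons; apply: subspaceD; first exact: subspace_piece.
  have -> : b0 + a = (b0 + b) + (a - b) by rewrite addrACA subrr addr0.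
  by apply: piece_wcons => //; apply: VD.
have -> : b0 + a = b + (b0 + (a - b)) by rewrite addrCA [b + _]addrC subrK.
by apply: piece_wcons => //; apply: IH.
Qed.

(** Additivity of [chi] makes the eigenvalues of the factors add up; thus the weights that separate
    degrees in [L] also separate them on chains. *)
Lemma piece_der_weight V (D : {linear L -> L}) (chi : {additive G -> K}) n a w :
  (forall c y, V c y -> D y = chi c *: y) ->
  piece V n a w -> der D n w = chi a *: w.
Proof.
move=> VD; elim: n a w => [|n IH] a w.
  have [->|a0] := eqVneq a 0; first by rewrite raddf0 scale0r der_ext0.
  by move=> /(piece0N a0) ->; rewrite linear0 scaler0.
move: w; apply: piece_ind => [|b y w Vy Vw].
  split=> [|c u v /= hu hv]; rewrite /= ?linear0 ?scaler0 //.
  by rewrite linearP /= hu hv scalerDr !scalerA mulrC.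
rewrite /= der_wcons (VD b) // (IH _ _ Vw) wconsZ linearZ /= -scalerDl.
by rewrite raddfB addrC subrK.
Qed.

Lemma piece_bd V n a w :
  (forall b c y z, V b y -> V c z -> V (b + c) (lie y z)) ->
  piece V n.+1 a w -> piece V n a (bd w).
Proof.
move=> Vl; elim: n a w => [|n IH] a w; move: w; apply: piece_ind.
- exact: (subspace_preimg (@bd K L 0) (subspace_piece V 0 a)).
- by move=> b y w _ _ /=; rewrite bd_wcons0; apply: piece_0.
- exact: (subspace_preimg (@bd K L n.+1) (subspace_piece V n.+1 a)).
move=> b y w Vy Vw /=; rewrite bd_wcons.
have e : a = b + (a - b) by rewrite addrC subrK.
apply: subspaceD; [exact: subspace_piece|apply: subspaceN..]; try exact: subspace_piece.
  by rewrite [a]e; apply: piece_der => // c z; apply: Vl.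
by rewrite [a]e; apply: piece_wcons => //; apply: IH.
Qed.

Definition bdimg (U : G -> set L) n a : set (ext L n) := [set bd w | w in piece U n.+1 a].
Arguments bdimg : clear implicits.

(** For odd [m] this is [\sum_(i <= m) (-1) ^ i dim H_i] in degree [a], since
    the ranks of the boundaries telescope. *)
Definition trunc_euler (U : G -> set L) m a : rat :=
  \sum_(i < m.+1) (-1) ^+ i * (vdim (piece U i a))%:R + (vdim (bdimg U m a))%:R.

(** * Passage to an ideal of codimension one *)

Section Step.
Variables (V : G -> set L) (delta : G) (x : L) (phi : {linear L -> K^o}).
Hypothesis sV : forall b, subspace (V b).
Hypothesis Vl : forall b c y z, V b y -> V c z -> V (b + c) (lie y z).
Hypothesis Vx : V delta x.
Hypothesis phix : phi x = 1.
Hypothesis phiN : forall c y, c != delta -> V c y -> phi y = 0.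
Hypothesis phil : forall b c y z, V b y -> V c z -> phi (lie y z) = 0.

(** When [x] has minimal degree in [V], this is the ideal of codimension one in
    the step of the induction. *)
Definition kerpiece c : set L := V c `&` [set y | phi y = 0].
Local Notation V' := kerpiece.

Lemma kerpieceS c : V' c `<=` V c. Proof. by move=> y []. Qed.

Lemma subspace_kerpiece c : subspace (V' c).
Proof. by apply: subspaceI => //; apply: subspace_ker. Qed.

Lemma kerpiece_lie b c y z : V b y -> V c z -> V' (b + c) (lie y z).
Proof. by move=> Vy Vz; split; [apply: Vl|apply: phil Vy Vz]. Qed.

Lemma kerpiece_split b y : V b y ->
  exists y' (k : K), [/\ V' b y', y = y' + k *: x & k = 0 \/ b = delta].
Proof.
move=> Vy; exists (y - (phi y : K) *: x), (phi y); rewrite subrK.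
have [bd|/phiN phi0] := eqVneq b delta; last first.
  by rewrite phi0 // scale0r subr0; split; [split; rewrite //= phi0| |left].
split; [split| |right] => //; last first.
  by rewrite /= linearB linearZ /= phix /GRing.scale /= mulr1 subrr.
by apply: subspaceD => //; apply: subspaceN => //; apply: subspaceZ => //; rewrite bd.
Qed.

(** The decomposition of the exterior power of [V] into that of [V'] and [x] wedge the next lower
    power of [V']. *)
Definition splits n a : set (ext L n.+1) :=
  [set w | exists u v, [/\ piece V' n.+1 a u, piece V' n (a - delta) v
    & w = u + wcons n x v]].
Arguments splits : clear implicits.

Lemma subspace_splits n a : subspace (splits n a).
Proof.
split; first by exists 0, 0; rewrite linear0 addr0; split=> //; apply: piece_0.
move=> c _ _ [u [v [hu hv ->]]] [u' [v' [hu' hv' ->]]]; exists (c *: u + u'), (c *: v + v').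
by split; [exact: piece_lin|exact: piece_lin|rewrite linearP scalerDr addrACA].
Qed.

Lemma piece_split n a w : piece V n.+1 a w -> splits n a w.
Proof.
elim: n a w => [|n IH] a w; move: w; apply: piece_ind => [|b y w Vy Vw].
- exact: subspace_splits.
- have [y' [k [V'y -> kb]]] := kerpiece_split Vy.
  rewrite (piece0_eq V V') in Vw; exists (wcons 0 y' w), (k *: w).
  rewrite wconsD wconsZ linearZ; split=> //.
    by rewrite -[a](subrK b) addrC; apply: piece_wcons.
  case: kb => [->|<-]; last by apply: subspaceZ => //; apply: subspace_piece.
  by rewrite scale0r; apply: piece_0.
- exact: subspace_splits.
have [y' [k [V'y -> kb]]] := kerpiece_split Vy.
have [u [v [V'u V'v ->]]] := IH _ _ Vw.
exists (wcons _ y' u), (- wcons _ y' v + k *: u); split.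
- by rewrite -[a](subrK b) addrC; apply: piece_wcons.
- apply: subspaceD; first exact: subspace_piece.
    apply: subspaceN; first exact: subspace_piece.
    have -> : a - delta = b + (a - b - delta) by rewrite addrA addrCA subrr addr0.
    exact: piece_wcons.
  case: kb => [->|<-]; first by rewrite scale0r; apply: piece_0.
  by apply: subspaceZ => //; apply: subspace_piece.
rewrite wconsD wconsZ !linearD /= wconsxx ?scaler0 ?addr0 (wconsC y' x) linearN linearZ /=.
by rewrite addrA.
Qed.

Lemma iota_kerpiece n a w : piece V' n.+1 a w -> iota_ext phi n w = 0.
Proof.
elim: n a w => [|n IH] a w; move: w; apply: piece_ind => [|b y w [_ phiy] V'w] /=.
- exact: subspace_ker.
- by rewrite iota_wcons0 phiy scale0r.
- exact: subspace_ker.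
by rewrite iota_wcons phiy scale0r (IH _ _ V'w) linear0 subr0.
Qed.

(** As [phi] is 1 on [x] and kills [V'], the interior product inverts [x] wedge on the powers of
    [V'], and so projects onto the second summand of [splits]. *)
Lemma iota_wconsx n a v : piece V' n a v -> iota_ext phi n (wcons n x v) = v.
Proof.
case: n v => [|n] v V'v; first by rewrite iota_wcons0 phix scale1r.
by rewrite iota_wcons phix scale1r (iota_kerpiece V'v) linear0 subr0.
Qed.

Lemma piece_wconsx n a v : piece V' n (a - delta) v -> piece V n.+1 a (wcons n x v).
Proof.
move=> V'v; rewrite -[a](subrK delta) addrC; apply: piece_wcons => //.
by apply: pieceS V'v; apply: kerpieceS.
Qed.

Hypothesis fV : forall n a, finspan (piece V n a).

Lemma finspan_kerpiece n a : finspan (piece V' n a).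
Proof. by apply: finspan_sub (fV n a); apply: pieceS; apply: kerpieceS. Qed.

(** Rank-nullity for the interior product with [phi]: its kernel is the power of [V'] of the same
    exterior degree, its image the next lower one. *)
Lemma vdim_piece_step n a :
  vdim (piece V n.+1 a) = (vdim (piece V' n.+1 a) + vdim (piece V' n (a - delta)))%N.
Proof.
rewrite (vdim_ker_img (iota_ext phi n)) //; last exact: subspace_piece.
congr (_ + _)%N; congr (@vdim K _ _); apply/seteqP; split=> w.
- move=> [/piece_split[u [v [V'u V'v ->]]]] /=.
  rewrite linearD /= (iota_kerpiece V'u) (iota_wconsx V'v) add0r => ->.
  by rewrite linear0 addr0.
- move=> V'w; split; first by apply: pieceS V'w; apply: kerpieceS.
  exact: iota_kerpiece V'w.
- move=> [_ /piece_split[u [v [V'u V'v ->]]] <-].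
  by rewrite linearD /= (iota_kerpiece V'u) (iota_wconsx V'v) add0r.
- by move=> V'w; exists (wcons n x w); [apply: piece_wconsx|apply: iota_wconsx V'w].
Qed.


Lemma subspace_bdimg U n a : subspace (bdimg U n a).
Proof. exact: (subspace_img (@bd K L n) (subspace_piece U n.+1 a)). Qed.

Lemma finspan_bdimg n a : finspan (bdimg V n a).
Proof. exact: (finspan_img (@bd K L n) (fV n.+1 a)). Qed.

Lemma bdimg_kerpiece n a : bdimg V' n a `<=` bdimg V n a.
Proof. by move=> _ [w V'w <-]; exists w => //; apply: pieceS V'w; apply: kerpieceS. Qed.

(** [bd (x /\ bd w)] is [- bd] of the derivative of [w] along [x], hence the map
    [v |-> bd (x /\ v)] modulo [bdimg V' n a] kills [bdimg V' n (a - delta)]. *)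
Lemma vdim_bdimg_step n a :
  (vdim (bdimg V n a) + vdim (bdimg V' n (a - delta))
   <= vdim (bdimg V' n a) + vdim (piece V' n (a - delta)))%N.
Proof.
have fV' m b : finspan (bdimg V' m b).
  by apply: finspan_sub (finspan_bdimg m b); apply: bdimg_kerpiece.
pose q : {linear ext L n -> modquot (bdimg V' n a)} := mqpi (bdimg V' n a).
have q0 w : q w = 0 <-> bdimg V' n a w.
  have -> : (q w = 0) = (w \in lspan (bdimg V' n a)).
    by apply/propext; rewrite -(linear0 q); split=> [/eqP|h];
       [|apply/eqP; move: h]; rewrite mqpi_eq subr0.
  by split=> [/lspan_id|/lspan_incl //]; apply; apply: subspace_bdimg.
pose g : {linear ext L n -> _} := q \o @bd K L n \o wcons n x.
have gE v : g v = q (bd (wcons n x v)) by [].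
have sP := subspace_piece V' n (a - delta).
have fP := finspan_kerpiece n (a - delta).
rewrite (vdim_ker_img q (subspace_bdimg V n a) (finspan_bdimg n a)).
have -> : bdimg V n a `&` [set w | q w = 0] = bdimg V' n a.
  apply/seteqP; split=> w; first by case=> _ /q0.
  by move=> V'w; split; [apply: bdimg_kerpiece|apply/q0].
have -> : [set q w | w in bdimg V n a] = [set g v | v in piece V' n (a - delta)].
  apply/seteqP; split=> [_ [_ [w /piece_split[u [v [V'u V'v ->]]] <-] <-]|_ [v V'v <-]].
    exists v => //; rewrite gE (linearD (@bd K L n)) (linearD q).
    by rewrite (_ : q (bd u) = 0) ?add0r //; apply/q0; exists u.
  by exists (bd (wcons n x v)) => //; exists (wcons n x v) => //; apply: piece_wconsx.
rewrite (vdim_ker_img g sP fP) -addnA leq_add2l addnC leq_add2r; apply: vdimS => //.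
- exact: subspace_bdimg.
- by apply: subspaceI => //; apply: subspace_ker.
- by apply: finspan_sub fP => w [].
move=> _ [w V'w <-]; split.
  by apply: piece_bd V'w => b c y z [Vy _] [Vz _]; apply: kerpiece_lie.
change (q (bd (wcons n x (bd w))) = 0); apply/q0; exists (- der (ad x) n.+1 w).
  apply: subspaceN; first exact: subspace_piece.
  have -> : a = delta + (a - delta) by rewrite addrC subrK.
  by apply: piece_der => // c y [Vy _]; apply: kerpiece_lie.
have := bd_bd (wcons n.+1 x w); rewrite bd_wcons linearB /= => /eqP.
by rewrite subr_eq0 => /eqP.
Qed.

Lemma trunc_euler_step m a : odd m ->
  trunc_euler V m a <= trunc_euler V' m a - trunc_euler V' m (a - delta).
Proof.
move=> om; rewrite /trunc_euler.
(* The shifted sum stops at [m - 1]. Its missing term, of sign -1 since [m] is odd, is exactly the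
   dimension that [vdim_bdimg_step] contributes. *)
have -> : \sum_(i < m.+1) (-1) ^+ i * (vdim (piece V i a))%:R =
    \sum_(i < m.+1) (-1) ^+ i * (vdim (piece V' i a))%:R
    - \sum_(i < m) (-1) ^+ i * (vdim (piece V' i (a - delta)))%:R :> rat.
  rewrite big_ord_recl [X in _ = X - _]big_ord_recl (piece0_eq V V') -addrA; congr (_ + _).
  rewrite -sumrN -big_split; apply: eq_bigr => i _ /=.
  by rewrite [bump _ _]add1n vdim_piece_step natrD exprS; ring.
rewrite [X in _ - (X + _)]big_ord_recr /= -signr_odd om.
have := vdim_bdimg_step m a; rewrite -(ler_nat rat) !natrD.
set A := \sum_(i < m.+1) _; set B := \sum_(i < m) _.
by move=> h; rewrite expr1 mulN1r; lra.
Qed.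

End Step.
End ExteriorPieces.

Arguments bdimg {K L G} U n a.

(** * Positive gradings *)

Section HeightGrading.
Variables (K : fieldType) (L : lieType K).
Local Notation G := 'rV[int]_3.
Implicit Types (V : G -> set L) (a b : G).

Definition height (a : G) : int := \sum_i a 0 i.
Definition nonneg (a : G) := forall i, 0 <= a 0 i.

Lemma heightD a b : height (a + b) = height a + height b.
Proof. by rewrite -big_split; apply: eq_bigr => i _; rewrite mxE. Qed.

Lemma height0 : height 0 = 0.
Proof. by apply: big1 => i _; rewrite mxE. Qed.

Lemma nonnegD a b : nonneg a -> nonneg b -> nonneg (a + b).
Proof. by move=> na nb i; rewrite mxE addr_ge0. Qed.

Lemma root3E (a : G) : a = root3 (a 0 0) (a 0 1) (a 0 2%:R).
Proof.
apply/rowP => j; rewrite mxE.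
by case: j => [[|[|[|j]]] jl] //=; congr (a 0 _); apply/val_inj.
Qed.

Lemma height_root3 (a b c : int) : height (root3 a b c) = a + b + c.
Proof. by rewrite /height !big_ord_recl big_ord0 !mxE /= addr0 addrA. Qed.

Lemma nonneg_root3 (a b c : int) : nonneg (root3 a b c) <-> [/\ 0 <= a, 0 <= b & 0 <= c].
Proof.
split=> [n|[a0 b0 c0] i]; last by rewrite mxE; case: i => [[|[|[|i]]] il].
by have := n 0; have := n 1; have := n 2%:R; rewrite !mxE.
Qed.

Lemma root3B (a b c a' b' c' : int) :
  root3 a b c - root3 a' b' c' = root3 (a - a') (b - b') (c - c').
Proof. by apply/rowP => j; rewrite !mxE; case: j => [[|[|[|j]]] jl]. Qed.

(** Each of the [n] factors has height at least [k]. Below, [k] is 0, 1 or [N + 1], according to the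
    information needed. *)
Lemma piece_support (V : G -> set L) k n a w :
  (forall b y, V b y -> y <> 0 -> nonneg b /\ k <= height b) ->
  piece V n a w -> w <> 0 -> nonneg a /\ k *+ n <= height a.
Proof.
move=> Vk Vw nz; apply: contrapT => na; apply: nz.
elim: n a w Vw na => [|n IH] a w Vw na.
  have [a0|a0] := eqVneq a 0; last exact: piece0N Vw.
  by case: na; rewrite a0 height0 mulr0n; split=> // i; rewrite mxE.
move: w Vw; apply: piece_ind => [|b y w Vy Vw].
  by split=> // c x y -> ->; rewrite scaler0 addr0.
have [->|/eqP y0] := eqVneq y 0; first exact: wcons0.
have [nb hb] := Vk _ _ Vy y0.
have [[nab hab]|nab] := EM (nonneg (a - b) /\ k *+ n <= height (a - b)).
  case: na; rewrite -[a](subrK b); split; first exact: nonnegD.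
  by rewrite heightD mulrSr lerD.
by rewrite (IH _ _ Vw nab) linear0.
Qed.

Lemma finspan_seq (U : lmodType K) (S : set U) (s : seq U) :
  (forall x, S x -> x \in lspan [set y | y \in s]) -> finspan S.
Proof.
move=> sS; exists (size s), (fun i => s`_i) => x /sS/lspanP.
elim=> [|a u v /= us _ [c ->]]; first by exists (fun=> 0); rewrite big1 // => i; rewrite scale0r.
have ui : (index u s < size s)%N by rewrite index_mem.
exists (fun i => (i == Ordinal ui)%:R * a + c i).
under [RHS]eq_bigr do rewrite scalerDl.
rewrite big_split /=; congr (_ + _).
rewrite (bigD1 (Ordinal ui)) //= eqxx mul1r nth_index // big1 ?addr0 // => i /negbTE ->.
by rewrite mul0r scale0r.
Qed.

Lemma finspanP (U : lmodType K) (S : set U) : finspan S ->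
  exists s : seq U, forall x, S x -> x \in lspan [set y | y \in s].
Proof.
move=> [n [v sp]]; exists (codom v) => x /sp[c ->].
by apply: rpred_sum => i _; apply: rpredZ; apply: lspan_incl; apply: codom_f.
Qed.

(** A finite list that includes every [b] between 0 and [a] coordinatewise, the only possible
    degrees of a factor in a chain of degree [a]. *)
Definition box (a : G) : seq G :=
  let q := (\max_i absz (a 0%R i))%N in
  codom (fun u : 'rV['I_q.+1]_3 => map_mx (fun i : 'I_q.+1 => (i : nat)%:Z) u).

Lemma boxP (a b : G) : nonneg b -> nonneg (a - b) -> b \in box a.
Proof.
move=> nb nab; rewrite /box; set q := \max_i _.
have bi i : b 0 i = absz (b 0%R i) by have := nb i; lia.
apply/codomP; exists (map_mx (fun z => inord (absz z)) b).
apply/rowP => i; rewrite !mxE inordK //.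
have ba : b 0 i <= a 0 i by have := nab i; rewrite !mxE subr_ge0.
rewrite ltnS; apply: leq_trans (leq_bigmax (F := fun i => absz (a 0%R i)) i).
by have := nb i; lia.
Qed.

Lemma finspan_piece (V : G -> set L) n a :
  (forall b, finspan (V b)) -> (forall b y, V b y -> y <> 0 -> nonneg b /\ 0 < height b) ->
  finspan (piece V n a).
Proof.
move=> fV Vs; elim: n a => [|n IH] a.
  apply: (@finspan_seq _ _ [:: wedge [ffun=> 0]]) => w _; move: w.
  apply: ext_ind => [|x]; first exact: subspace_lspan.
  apply: lspan_incl => /=; rewrite inE; apply/eqP; congr wedge.
  by apply/ffunP => -[].
have [sV hV] := choice (fun b => finspanP (fV b)).
have [sW hW] := choice (fun b => finspanP (IH (a - b))).
apply: (@finspan_seq _ _ (flatten [seq [seq wcons n y w | y <- sV b, w <- sW b] | b <- box a])).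
apply: piece_ind => [|b y w Vy Vw]; first exact: subspace_lspan.
have [->|/eqP y0] := eqVneq y 0; first by rewrite wcons0 rpred0.
have [->|/eqP w0] := eqVneq w 0; first by rewrite linear0 rpred0.
have Vs' c z : V c z -> z <> 0 -> nonneg c /\ 0 <= height c.
  by move=> Vz /(Vs _ _ Vz)[nc /ltW].
have bs := boxP (Vs' _ _ Vy y0).1 (piece_support Vs' Vw w0).1.
have /lspanP := hV _ _ Vy; elim=> [|c u v /= us _ IHu]; first by rewrite wcons0 rpred0.
rewrite wcons_lin rpredD // rpredZ //.
have /lspanP := hW _ _ Vw; elim=> [|c' u' v' /= us' _ IHu']; first by rewrite linear0 rpred0.
rewrite linearP rpredD // rpredZ //; apply: lspan_incl => /=.
apply/flattenP; exists [seq wcons n y w | y <- sV b, w <- sW b]; first exact: map_f.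
exact: allpairs_f.
Qed.

(** The conditions that pass from [V] to [kerpiece V phi]. The last one provides a functional that
    is 1 on a chosen homogeneous vector and 0 in all other degrees. *)
Record positive_grading (V : G -> set L) : Prop := PositiveGrading {
  pg_subspace : forall b, subspace (V b);
  pg_finspan : forall b, finspan (V b);
  pg_support : forall b y, V b y -> y <> 0 -> nonneg b /\ 0 < height b;
  pg_lie : forall b c y z, V b y -> V c z -> V (b + c) (lie y z);
  pg_direct : forall b y, V b y -> y \in lspan (others V b) -> y = 0
}.

Lemma pg_support1 V b y : positive_grading V -> V b y -> y <> 0 ->
  nonneg b /\ 1 <= height b.
Proof. by move=> gV Vy /(pg_support gV Vy)[nb]; rewrite gtz0_ge1. Qed.

Section TruncatedEuler.
Variable m : nat.

(** Needed where [a - delta] leaves the nonnegative cone: multiplication by a monomial gives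
    coefficient 0 there. *)
Lemma trunc_euler_out V a : positive_grading V -> ~ nonneg a -> trunc_euler V m a = 0.
Proof.
move=> gV na.
have p0 i w : piece V i a w -> w = 0.
  move=> Vw; apply: contrapT => w0; apply: na.
  exact: (piece_support (fun b y => @pg_support1 V b y gV) Vw w0).1.
rewrite /trunc_euler vdim_set0 ?addr0 => [|_ [w /p0 -> <-]]; last exact: linear0.
by rewrite big1 // => i _; rewrite vdim_set0 ?mulr0 //; apply: p0.
Qed.

Lemma vdim_piece0 V : vdim (piece V 0 0) = 1%N.
Proof.
(* The constant 1 is vacuously multilinear and alternating on empty tuples; its lift shows that the
   empty wedge is not 0. *)
have [F hF] := @extlift K L 0 K^o (fun=> 1) (fun x i => False_rect _ (notF (ltn_ord i)))
  (fun x i => False_rect _ (notF (ltn_ord i))).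
apply: (@basis_vdim _ _ _ _ (fun _ : 'I_1 => wedge [ffun=> 0])); split=> [_|c|x _].
- exact: piece0T.
- rewrite big_ord1 => /(congr1 F); rewrite linearZ linear0 hF => c0 i.
  by rewrite (ord1 i) -[c _]mulr1; exact: c0.
move: x; apply: ext_ind => [|x].
  split; first by exists (fun=> 0); rewrite big1 // => i; rewrite scale0r.
  move=> a _ _ [c ->] [c' ->]; exists (fun i => a * c i + c' i).
  by rewrite !big_ord1 scalerDl scalerA.
exists (fun=> 1); rewrite big_ord1 scale1r; congr wedge.
by apply/ffunP => -[].
Qed.

Lemma trunc_euler_low V N a : positive_grading V ->
  (forall b y, V b y -> y <> 0 -> N < height b) -> 0 <= N -> height a <= N ->
  trunc_euler V m a = (a == 0)%:R.
Proof.
move=> gV Vh N0 ha.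
have p0 i w : piece V i.+1 a w -> w = 0.
  move=> Vw; apply: contrapT => w0.
  have V1 b y : V b y -> y <> 0 -> nonneg b /\ N + 1 <= height b.
    move=> Vy y0; split; first exact: (pg_support gV Vy y0).1.
    by have := Vh _ _ Vy y0; lia.
  have := le_trans (piece_support V1 Vw w0).2 ha; rewrite mulrSr.
  have : 0 <= (N + 1) *+ i by apply: mulrn_wge0; lia.
  by lia.
rewrite /trunc_euler vdim_set0 ?addr0 => [|_ [w /p0 -> <-]]; last exact: linear0.
rewrite big_ord_recl big1 => [|i _]; last by rewrite vdim_set0 ?mulr0 //; apply: p0.
rewrite expr0 mul1r addr0; have [->|a0] := eqVneq a 0; first by rewrite vdim_piece0.
by rewrite vdim_set0 // => w; apply: piece0N.
Qed.

Definition euler_series V : fs := fun (a b c : nat) => trunc_euler V m (root3 a b c).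
Definition dim_series (V : G -> set L) : fs := fun (a b c : nat) => (vdim (V (root3 a b c)))%:R.

Lemma unital_euler_series V : positive_grading V -> unital (euler_series V).
Proof.
move=> gV; have e0 : root3 0 0 0 = 0.
  by apply/rowP => j; rewrite !mxE; case: j => [[|[|[|j]]] jl].
rewrite /unital /euler_series e0 (@trunc_euler_low _ 0) ?eqxx ?height0 //.
by move=> b y Vy y0; have [] := pg_support gV Vy y0.
Qed.

Lemma positive_grading_ker V (phi : {linear L -> K^o}) : positive_grading V ->
  (forall b c y z, V b y -> V c z -> phi (lie y z) = 0) ->
  positive_grading (kerpiece V phi).
Proof.
move=> gV phil; split.
- by move=> b; apply: subspace_kerpiece; apply: pg_subspace.
- by move=> b; apply: finspan_sub (pg_finspan gV b) => y [].
- by move=> b y [Vy _] y0; apply: (pg_support gV Vy y0).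
- by move=> b c y z [Vy _] [Vz _]; apply: kerpiece_lie => //; apply: pg_lie.
- move=> b y [Vy _] oy; apply: (pg_direct gV Vy); apply: lspanS oy => z [c cb [Vz _]].
  by exists c.
Qed.

Lemma vdim_kerpiece V (phi : {linear L -> K^o}) delta x c : positive_grading V ->
  V delta x -> phi x = 1 -> (forall c y, c != delta -> V c y -> phi y = 0) ->
  vdim (V c) = ((c == delta) + vdim (kerpiece V phi c))%N.
Proof.
move=> gV Vx phix phiN.
rewrite (vdim_ker_img phi (pg_subspace gV c) (pg_finspan gV c)) addnC; congr (_ + _)%N.
have [->|cd] := eqVneq c delta; last by apply: vdim_set0 => _ [y Vy <-]; apply: phiN Vy.
apply: (@basis_vdim _ _ _ _ (fun _ : 'I_1 => 1 : K^o)); split=> [_|k|k _].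
- by exists x.
- by rewrite big_ord1 /GRing.scale /= mulr1 => k0 i; rewrite (ord1 i).
by exists (fun=> k); rewrite big_ord1 /GRing.scale /= mulr1.
Qed.

(** Induction on the number [mu V] of basis vectors in the box, which contains
    all degrees of height at most [N]. *)
Lemma euler_series_bound (om : odd m) N V : positive_grading V ->
  log_bound N (euler_series V) (dim_series V).
Proof.
pose mu V := (\sum_(b : 'rV['I_N.+1]_3)
  vdim ((V : G -> set L) (map_mx (fun i : 'I_N.+1 => (i : nat)%:Z) b)))%N.
have [d] := ubnP (mu V); elim: d V => // d IH V; rewrite ltnS => mud gV.
have [low|] := EM (forall b y, V b y -> y <> 0 -> N%:Z < height b).
  apply: log_bound_vanish => a b c lt.
    have ha : height (root3 a b c) <= N%:Z by rewrite height_root3; lia.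
    rewrite fsB fs1 /euler_series (trunc_euler_low gV low _ ha) //.
    suff -> : (root3 a b c == 0) = ((a + b + c)%N == 0%N) by rewrite subrr.
    apply/eqP/eqP => [/(congr1 height)|]; rewrite ?height_root3 ?height0; first by lia.
    move=> /eqP; rewrite !addn_eq0 => /andP[/andP[/eqP -> /eqP ->] /eqP ->].
    by apply/rowP => j; rewrite !mxE; case: j => [[|[|[|j]]] jl].
  rewrite /dim_series vdim_set0 // => y Vy; apply: contrapT => y0.
  by have := low _ _ Vy y0; rewrite height_root3; lia.
move=> nlow.
pose Q k := `[< exists b y, [/\ V b y, y <> 0 & height b = k%:Z] >].
have hQ b y : V b y -> y <> 0 -> Q `|height b|%N.
  move=> Vy y0; apply/asboolP; exists b, y; split=> //.
  by have [_ h0] := pg_support gV Vy y0; lia.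
have [k1 [Qk1 k1N]] : exists k, Q k /\ (k <= N)%N.
  apply: contrapT => nk; apply: nlow => b y Vy y0.
  rewrite ltNge; apply/negP => hb; apply: nk; exists `|height b|%N.
  by split; [exact: hQ Vy y0|have [_ h0] := pg_support gV Vy y0; lia].
have [k0 /asboolP[delta [x [Vx x0 hk]]] kmin] := ex_minnP (ex_intro Q _ Qk1).
have kN : (k0 <= N)%N by apply: leq_trans k1N; apply: kmin.
have hmin b y : V b y -> y <> 0 -> height delta <= height b.
  move=> Vy y0; have := kmin _ (hQ _ _ Vy y0); have [_ h0] := pg_support gV Vy y0; lia.
(* Directness of the grading keeps [x] out of the span of all the other degrees together. *)
have [||phi [phix phiO]] := @functional_separating _ _ [set y | y \in lspan (others V delta)] x.
- exact: subspace_lspan.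
- by move=> ox; apply: x0; apply: (pg_direct gV Vx).
have phiN c y : c != delta -> V c y -> phi y = 0.
  by move=> /eqP cd Vy; apply: phiO; apply: lspan_incl; exists c.
(* One factor has height at least that of [delta], the other has positive height, so the bracket
   sits in a degree different from [delta]. *)
have phil b c y z : V b y -> V c z -> phi (lie y z) = 0.
  move=> Vy Vz; have [->|/eqP y0] := eqVneq y 0; first by rewrite lie0l linear0.
  have [->|/eqP z0] := eqVneq z 0; first by rewrite lie0r linear0.
  apply: (phiN (b + c)); last exact: pg_lie.
  apply/eqP => /(congr1 height); rewrite heightD.
  have := hmin _ _ Vy y0; have [_] := pg_support gV Vz z0; lia.
have gV' := positive_grading_ker gV phil.
have dimV c := vdim_kerpiece c gV Vx phix phiN.
have [nd hd] := pg_support gV Vx x0.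
pose i := absz (delta 0%R 0%R); pose j := absz (delta 0%R 1); pose k := absz (delta 0%R 2%:R).
have dE : delta = root3 i j k.
  rewrite [LHS]root3E /i /j /k; have := nd 0; have := nd 1; have := nd 2%:R.
  by move=> h1 h2 h3; congr root3; lia.
have ijk : (i + j + k = k0)%N by apply/eqP; rewrite -eqz_nat -hk dE height_root3; lia.
have -> : dim_series V = mono i j k + dim_series (kerpiece V phi).
  apply/funext => a; apply/funext => b; apply/funext => c.
  rewrite fsD /dim_series dimV natrD; congr (_ + _); rewrite /mono; congr (_%:R).
  congr nat_of_bool; rewrite dE.
  apply/eqP/andP => [/rowP e|[/andP[/eqP -> /eqP ->] /eqP -> //]].
  have := e 0; have := e 1; have := e 2%:R; rewrite !mxE /= => -[->] [->] [->].
  by rewrite !eqxx.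
apply: log_bound_step => //.
- by rewrite -ltz_nat ijk -hk.
- exact: unital_euler_series.
(* All coordinates of [delta] are at most [N], so [delta] lies in the box and the count drops there;
   it does not increase in any other degree. *)
- apply: IH => //; apply: leq_trans mud; rewrite /mu.
  have ub z : (absz (delta 0%R z) < N.+1)%N.
    have le : delta 0 z <= height delta by rewrite /height (bigD1 z) //= lerDl sumr_ge0.
    by rewrite hk in le; have := nd z; lia.
  pose u : 'rV['I_N.+1]_3 := map_mx (fun z => inord (absz z)) delta.
  have uE : map_mx (fun i : 'I_N.+1 => (i : nat)%:Z) u = delta.
    by apply/rowP => z; rewrite !mxE inordK //; have := nd z; lia.
  rewrite (bigD1 u) //= [X in (_ < X)%N](bigD1 u) //= uE dimV eqxx addSn ltnS.
  by rewrite leq_add2l; apply: leq_sum => z _; rewrite dimV leq_addl.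
move=> a b c _; rewrite fsB mulrBl mul1r fsB monoM /euler_series -addrA -opprD subr_ge0.
have st := trunc_euler_step (pg_subspace gV) (pg_lie gV) Vx phix phiN phil
  (fun n a => finspan_piece n a (pg_finspan gV) (@pg_support _ gV)) (root3 a b c) om.
rewrite -lerBrDl; apply: le_trans st _; rewrite lerD2l lerN2 dE root3B.
case: ifPn => [/andP[/andP[ia jb] kc]|nle].
  by rewrite !subzn.
by rewrite trunc_euler_out // => /nonneg_root3[h1 h2 h3]; move: nle; lia.
Qed.

End TruncatedEuler.
End HeightGrading.

(** * Homology *)

Section HomologyDimension.
Variables (K : fieldType) (L : lieType K).
Local Notation G := 'rV[int]_3.
Variable gr : G -> set L.
Hypothesis ggr : positive_grading gr.
Hypothesis bd_graded : forall n a (w : ext L n.+1), piece gr n a (bd w) -> bdimg gr n a (bd w).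
Local Notation hpiece n a := (@homology_piece _ _ _ gr n a).

Lemma subspace_cycles n : subspace (@cycles K L n).
Proof. by case: n => [|n] //; apply: (subspace_ker (@bd K L n)). Qed.

Lemma finspan_grpiece n a : finspan (piece gr n a).
Proof. by apply: finspan_piece; [exact: pg_finspan|exact: pg_support]. Qed.

(** [homology_piece] divides by all boundaries, and [bd_graded] identifies the kernel on the cycles
    of degree [a] with the boundaries of chains of degree [a]. *)
Lemma vdim_cycles_piece n a :
  vdim (@cycles K L n `&` piece gr n a) = (vdim (hpiece n a) + vdim (bdimg gr n a))%N.
Proof.
pose f : {linear ext L n -> modquot (range (@bd K L n))} := mqpi (range (@bd K L n)).
have sC : subspace (@cycles K L n `&` piece gr n a).
  by apply: subspaceI; [exact: subspace_cycles|exact: subspace_piece].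
have fC : finspan (@cycles K L n `&` piece gr n a).
  by apply: finspan_sub (finspan_grpiece n a) => w [].
rewrite (vdim_ker_img f sC fC) addnC; congr (_ + _)%N; congr (@vdim K _ _).
have sR : subspace (range (@bd K L n)) by apply: subspace_img.
apply/seteqP; split=> [w [[_ pw] /eqP]|_ [w pw <-]].
  rewrite -(linear0 f) mqpi_eq subr0 => /(lspan_id sR)[u _ uw].
  by rewrite -uw; apply: bd_graded; rewrite uw.
split; last first.
  by apply/eqP; rewrite /= -(linear0 f) mqpi_eq subr0; apply: lspan_incl; exists w.
split; last by apply: piece_bd pw; apply: pg_lie.
by case: n w {f sC fC sR pw} => // n w; apply: bd_bd.
Qed.

Lemma vdim_homology0 a :
  (vdim (hpiece 0 a) + vdim (bdimg gr 0 a))%N = vdim (piece gr 0 a).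
Proof. by rewrite -vdim_cycles_piece setTI. Qed.

Lemma vdim_homologyS n a : (vdim (hpiece n.+1 a) + vdim (bdimg gr n.+1 a)
  + vdim (bdimg gr n a))%N = vdim (piece gr n.+1 a).
Proof.
rewrite -vdim_cycles_piece setIC.
by rewrite -(vdim_ker_img (@bd K L n)) //; [exact: subspace_piece|exact: finspan_grpiece].
Qed.

Lemma trunc_homology m a :
  \sum_(i < m.+1) (-1) ^+ i * (vdim (hpiece i a))%:R
  = \sum_(i < m.+1) (-1) ^+ i * (vdim (piece gr i a))%:R
    - (-1) ^+ m * (vdim (bdimg gr m a))%:R :> rat.
Proof.
elim: m => [|m IH].
  rewrite !big_ord1 !expr0 !mul1r -vdim_homology0 natrD; ring.
rewrite big_ord_recr [X in _ = X - _]big_ord_recr /= {}IH -vdim_homologyS !natrD exprS.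
by ring.
Qed.

Lemma trunc_homology_odd m a : odd m ->
  \sum_(i < m.+1) (-1) ^+ i * (vdim (hpiece i a))%:R = trunc_euler gr m a.
Proof.
by move=> om; rewrite trunc_homology /trunc_euler -signr_odd om expr1 mulN1r opprK.
Qed.

End HomologyDimension.

(** * Homogeneous boundaries bound homogeneous chains *)

Section BoundaryGraded.
Variables (K : fieldType) (L : lieType K).
Local Notation G := 'rV[int]_3.
Variables (I : Type) (gr : G -> set L) (D : I -> {linear L -> L}).
Variable chi : I -> {additive G -> K}.
Hypothesis grD : forall i a x, gr a x -> D i x = chi i a *: x.
Hypothesis chi_inj : forall a b, a <> b -> exists i, chi i a <> chi i b.
Hypothesis gr_lie : forall b c y z, gr b y -> gr c z -> gr (b + c) (lie y z).
Hypothesis gr_span : forall x, x \in lspan [set x | exists b, gr b x].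

Lemma piece_weight n a :
  piece gr n a `<=` weight_space (fun i => der (D i) n) (fun a i => chi i a) a.
Proof. by move=> w gw i; apply: piece_der_weight gw => c y; apply: grD. Qed.

Lemma ext_span n (w : ext L n) : w \in lspan [set w | exists a, piece gr n a w].
Proof.
elim: n w => [|n IH] w.
  by apply: lspan_incl; exists 0; apply: piece0T.
move: w; apply: ext_ind => [|x]; first exact: subspace_lspan.
rewrite [x]fcons_eta -wcons_wedge; move: (x ord0) (wedge _) => y w.
have /lspanP := gr_span y; elim=> [|c u v [b gu] _ IHv]; first by rewrite wcons0 rpred0.
rewrite wcons_lin rpredD // rpredZ //.
have /lspanP := IH w; elim=> [|c' u' v' [a gu'] _ IHv']; first by rewrite linear0 rpred0.
rewrite linearP rpredD // rpredZ //; apply: lspan_incl; exists (b + a).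
exact: piece_wcons.
Qed.

(** Replace [w] by its component [w'] of degree [a]. The boundary of [w - w'] has weight [a] and
    also lies in the span of the other weights, hence is 0. *)
Lemma bd_graded n a (w : ext L n.+1) : piece gr n a (bd w) -> bdimg gr n a (bd w).
Proof.
move=> bw.
have [w' gw' ww'] := lspan_component a (subspace_piece gr n.+1) (ext_span w).
exists w' => //; apply/eqP; rewrite eq_sym -subr_eq0 -linearB /=; apply/eqP.
apply: (@weight_indep _ _ _ _ (fun i => der (D i) n) (fun a i => chi i a) chi_inj a).
  apply: piece_weight; rewrite linearB /=; apply: subspaceD; first exact: subspace_piece.
    exact: bw.
  by apply: subspaceN; [exact: subspace_piece|apply: piece_bd gw'].
have /lspanP := ww'; elim=> [|c u v [b ba gu] _ IHv]; first by rewrite linear0 rpred0.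
rewrite linearP rpredD // rpredZ //; apply: lspan_incl; exists b => //.
by apply: piece_weight; apply: piece_bd gu.
Qed.

Lemma gr_direct b y : gr b y -> y \in lspan (others gr b) -> y = 0.
Proof.
move=> gy oy; apply: (@weight_indep _ _ _ _ D (fun a i => chi i a) chi_inj b) => [i|].
  exact: grD.
by apply: lspanS oy => x [c cb gx]; exists c => // i; apply: grD.
Qed.

End BoundaryGraded.

(** * Root spaces *)

Section KacMoodySpan.
Variables (K : fieldType) (n : nat) (A : 'M[int]_n).
Local Notation g := (kacmoody K A).

Definition km_proj (x : freeLie K (kmgen n)) : g :=
  lqpi (@km_radical K n A) (lqpi (@chevalley_rel K n A) x).

Lemma km_proj_linear : linear km_proj.
Proof. by move=> a x y; rewrite /km_proj !linearP. Qed.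
HB.instance Definition _ :=
  GRing.isLinear.Build K (freeLie K (kmgen n)) g *:%R km_proj km_proj_linear.

Lemma km_proj_lie x y : km_proj (lie x y) = lie (km_proj x) (km_proj y).
Proof.
have e1 u v : lie (lqpi (@chevalley_rel K n A) u) (lqpi (@chevalley_rel K n A) v) =
    lqpi (@chevalley_rel K n A) (lie u v) by exact: lq_lieE.
have e2 u v : lie (lqpi (@km_radical K n A) u) (lqpi (@km_radical K n A) v) =
    lqpi (@km_radical K n A) (lie u v) by exact: lq_lieE.
by rewrite /km_proj -e1 -e2.
Qed.

Lemma km_proj_rel r : chevalley_rel A r -> km_proj r = 0.
Proof.
move=> rr; rewrite /km_proj [lqpi (@chevalley_rel K n A) r](_ : _ = 0) ?linear0 //.
apply/eqP; rewrite -(linear0 (lqpi (@chevalley_rel K n A))) mqpi_eq subr0.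
by apply: lspan_incl; apply: ad_orbit0.
Qed.

Lemma km_proj_surj (x : g) : exists t, x = km_proj (\pi_(freeLie K (kmgen n)) t).
Proof. by exists (repr (repr (repr x))); rewrite reprK /km_proj !lqpi_repr. Qed.

Definition sgnb (s : bool) : int := if s then 1 else -1.
Definition kmx (s : bool) (i : 'I_n) : g := km_proj (flgen K (if s then KMe i else KMf i)).

Lemma km_proj_eq u v : chevalley_rel A (u - v) -> km_proj u = km_proj v.
Proof.
by move=> /km_proj_rel; rewrite linearB => /eqP; rewrite subr_eq0 => /eqP.
Qed.

Lemma km_hE i : km_h K A i = km_proj (flgen K (KMh i)).
Proof. by []. Qed.

Lemma lie_hh i j : lie (km_h K A i) (km_h K A j) = 0.
Proof. by rewrite !km_hE -km_proj_lie; apply: km_proj_rel; constructor. Qed.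

Lemma lie_hx s i j : lie (km_h K A i) (kmx s j) = (sgnb s * A i j)%:~R *: kmx s j.
Proof.
rewrite km_hE /kmx -km_proj_lie; case: s; rewrite /sgnb.
  by rewrite mul1r (km_proj_eq (chev_he K A i j)) linearZ.
have := km_proj_rel (chev_hf K A i j); rewrite linearD linearZ => /eqP.
by rewrite addr_eq0 => /eqP ->; rewrite mulN1r intrN scaleNr.
Qed.

Lemma lie_ef i j : lie (kmx true i) (kmx false j) = (i == j)%:R *: km_h K A i.
Proof. by rewrite km_hE /kmx -km_proj_lie (km_proj_eq (chev_ef K A i j)) linearZ. Qed.

Lemma lie_xx s i j : exists c, lie (kmx s i) (kmx (~~ s) j) = c *: km_h K A i.
Proof.
case: s; first by exists (i == j)%:R; rewrite lie_ef.
rewrite lieC lie_ef; have [->|_] := eqVneq j i; first by exists (-1); rewrite scale1r scaleN1r.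
by exists 0; rewrite !scale0r oppr0.
Qed.

(** Right-normed brackets of the [e_i] ([s = true]) or of the [f_i]. *)
Definition kmword (s : bool) (i : 'I_n) (w : seq 'I_n) : g :=
  foldr (fun j y => lie (kmx s j) y) (kmx s i) w.

Definition word_weight (s : bool) (i : 'I_n) (w : seq 'I_n) : 'rV[int]_n :=
  foldr (fun j a => sgnb s *: delta_mx 0 j + a) (sgnb s *: delta_mx 0 i) w.

Lemma rootspace_kmx s i : rootspace (sgnb s *: delta_mx 0 i) (kmx s i).
Proof.
move=> k; rewrite lie_hx; congr (_%:~R *: _); rewrite /km_weight (bigD1 i) //=.
rewrite big1 ?addr0 => [|j ji]; first by rewrite !mxE !eqxx mulr1 mulrC.
by rewrite !mxE (negbTE ji) !mulr0.
Qed.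

Lemma rootspace_kmword s i w : rootspace (word_weight s i w) (kmword s i w).
Proof.
elim: w => [|j w IH] /=; first exact: rootspace_kmx.
by apply: rootspace_lie => //; apply: rootspace_kmx.
Qed.

Lemma subspace_rootspace a : subspace (@rootspace K n A a).
Proof.
split=> [i|c x y hx hy i]; first by rewrite lie0r scaler0.
by rewrite lie_linearr hx hy scalerDr !scalerA mulrC.
Qed.

(** Its span is the Cartan part together with the positive or the negative part. Treating the two
    signs separately makes both kinds of generators preserve the span. *)
Definition half (s : bool) : set g :=
  [set x | (exists i, x = km_h K A i) \/ exists i w, x = kmword s i w].
Definition span_gens : set g :=
  [set x | (exists i, x = km_h K A i) \/ exists s i w, x = kmword s i w].

Lemma lspan_lie (S T : set g) y :
  (forall x, S x -> lie y x \in lspan T) -> forall x, x \in lspan S -> lie y x \in lspan T.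
Proof.
move=> ST x /lspanP; elim=> [|a u v Su _ IH]; first by rewrite lie0r rpred0.
by rewrite lie_linearr rpredD // rpredZ // ST.
Qed.

Lemma lie_h_kmword k s i w : exists c, lie (km_h K A k) (kmword s i w) = c *: kmword s i w.
Proof. by eexists; apply: rootspace_kmword. Qed.

Lemma half_h s i : km_h K A i \in lspan (half s).
Proof. by apply: lspan_incl; left; exists i. Qed.

Lemma half_word s i w : kmword s i w \in lspan (half s).
Proof. by apply: lspan_incl; right; exists i, w. Qed.

Lemma half_lie_x s j x : x \in lspan (half s) -> lie (kmx s j) x \in lspan (half s).
Proof.
apply: lspan_lie => {}x [[i ->]|[i [w ->]]].
  by rewrite lieC lie_hx -scaleNr rpredZ //; apply: (half_word s j [::]).
exact: (half_word s i (j :: w)).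
Qed.

Lemma half_lie_h s k x : x \in lspan (half s) -> lie (km_h K A k) x \in lspan (half s).
Proof.
apply: lspan_lie => {}x [[i ->]|[i [w ->]]]; first by rewrite lie_hh rpred0.
by have [c ->] := lie_h_kmword k s i w; rewrite rpredZ // half_word.
Qed.

(** The opposite generator travels inward through the word by the Jacobi identity; each letter it
    meets leaves a multiple of a coroot, which acts on the remaining word by a scalar. *)
Lemma half_lie_opp s j i w : lie (kmx (~~ s) j) (kmword s i w) \in lspan (half s).
Proof.
have hx k : exists c, lie (kmx (~~ s) j) (kmx s k) = c *: km_h K A j.
  by have := lie_xx (~~ s) j k; rewrite negbK.
elim: w => [|k w IH] /=; first by have [c ->] := hx i; rewrite rpredZ // half_h.
have -> (x y z : g) : lie x (lie y z) = lie (lie x y) z + lie y (lie x z).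
  have := lie_jacobi x y z; rewrite (lieC x z) lieNr (lieC (lie x y) z) => /eqP.
  by rewrite -addrA -opprD subr_eq0 addrC => /eqP.
rewrite rpredD //; last exact: half_lie_x.
have [c ->] := hx k; rewrite lieZl rpredZ //; exact/half_lie_h/half_word.
Qed.

Lemma half_span s : {subset lspan (half s) <= lspan span_gens}.
Proof. by apply: lspanS => x [hx|[i [w ->]]]; [left|right; exists s, i, w]. Qed.

Lemma span_gens_lie (k : kmgen n) x :
  x \in lspan span_gens -> lie (km_proj (flgen K k)) x \in lspan span_gens.
Proof.
have xP s j y : y \in lspan span_gens -> lie (kmx s j) y \in lspan span_gens.
  apply: lspan_lie => {}y [[i ->]|[s' [i [w ->]]]].
    by apply: (half_span (s := s)); apply/half_lie_x/half_h.
  apply: (half_span (s := s')); have [->|ss'] := eqVneq s s'.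
    exact/half_lie_x/half_word.
  have -> : s = ~~ s' by case: s s' ss' => -[].
  exact: half_lie_opp.
case: k => j; [exact: (xP true)|exact: (xP false)|].
apply: lspan_lie => {}x [[i ->]|[s [i [w ->]]]].
  by rewrite [lie _ _]lie_hh rpred0.
by apply: (half_span (s := s)); apply: half_lie_h; apply: half_word.
Qed.

Local Notation pi t := (\pi_(freeLie K (kmgen n)) t).

Lemma pi_add t u : pi (LAdd t u) = pi t + pi u. Proof. by rewrite -fl_addE. Qed.
Lemma pi_scale a t : pi (LScale a t) = a *: pi t. Proof. by rewrite -fl_scaleE. Qed.
Lemma pi_lie t u : pi (LLie t u) = lie (pi t) (pi u). Proof. by rewrite -fl_lieE. Qed.

Lemma span_gens_ideal t x :
  x \in lspan span_gens -> lie (km_proj (pi t)) x \in lspan span_gens.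
Proof.
elim: t x => [k||t IHt u IHu|a t IH|t IHt u IHu] x xs.
- exact: span_gens_lie.
- by rewrite [km_proj _]linear0 lie0l rpred0.
- by rewrite pi_add linearD lieDl rpredD ?IHt ?IHu.
- by rewrite pi_scale linearZ lieZl; apply: rpredZ; apply: IH.
rewrite pi_lie km_proj_lie.
have -> (y z w : g) : lie (lie y z) w = lie y (lie z w) - lie z (lie y w).
  have := lie_jacobi y z w; rewrite (lieC y w) lieNr (lieC (lie y z) w) => /eqP.
  by rewrite subr_eq0 => /eqP.
by apply: rpredB; [apply/IHt/IHu|apply/IHu/IHt].
Qed.

(** The spanning half of the triangular decomposition. The span contains the generators and is
    stable under the adjoint action of every element, which gives closure under brackets. *)
Lemma kacmoody_span (x : g) : x \in lspan span_gens.
Proof.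
have [t ->] := km_proj_surj x; elim: t => [k||t IHt u IHu|a t IH|t IHt u IHu].
- apply: lspan_incl; case: k => i; last by left; exists i.
    by right; exists true, i, [::].
  by right; exists false, i, [::].
- by rewrite [km_proj _]linear0 rpred0.
- by rewrite pi_add linearD rpredD.
- by rewrite pi_scale linearZ rpredZ.
by rewrite pi_lie km_proj_lie; apply: span_gens_ideal.
Qed.

Hypothesis weight_inj : forall a b : 'rV[int]_n, a <> b ->
  exists i, (km_weight A a i)%:~R <> (km_weight A b i)%:~R :> K.

Lemma rootspace_span a x : a <> 0 -> @rootspace K n A a x ->
  x \in lspan [set x | exists s i w, x = kmword s i w /\ word_weight s i w = a].
Proof.
move=> a0 xa.
(* The coroots are put in degree 0 so that the sets [S b] together span; they drop out at the end
   because [a] is not 0. *)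
pose S b : set g := [set x | x \in lspan [set x | (b = 0 /\ exists i, x = km_h K A i) \/
  exists s i w, x = kmword s i w /\ word_weight s i w = b]].
have sS b : subspace (S b) by apply: subspace_lspan.
have hS b : S b `<=` weight_space (fun i => ad (km_h K A i))
    (fun b i => (km_weight A b i)%:~R) b.
  move=> y Sy; have : @rootspace K n A b y; last by [].
  have /lspanP := Sy; elim=> [|c u v Su _ IHv]; first by case: (subspace_rootspace b).
  apply: (subspace_rootspace b).2 => //; case: Su => [[b0 [i ->]]|[s [i [w [-> <-]]]]].
    move=> j; rewrite lie_hh b0 /km_weight big1 ?scale0r // => k _.
    by rewrite mxE mulr0.
  exact: rootspace_kmword.
have := weight_component weight_inj (a := a) sS hS (x := x) _ xa.
have -> : x \in lspan [set x | exists b, S b x].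
  apply: lspanS (kacmoody_span x) => y [hy|[s [i [w ->]]]].
    by exists 0; apply: lspan_incl; left.
  by exists (word_weight s i w); apply: lspan_incl; right; exists s, i, w.
move=> /(_ isT); apply: lspanS => y [[/a0]|] //.
Qed.

End KacMoodySpan.

Lemma finspan_inj (K : fieldType) (U W : lmodType K) (f : {linear U -> W}) (S : set U) :
  injective f -> subspace S -> finspan [set f x | x in S] -> finspan S.
Proof.
move=> fi sS /(finspan_basis (subspace_img f sS))[v [Sv _ sp]].
have [u hu] := choice (fun i => let: ex_intro2 y _ e := Sv i in ex_intro (fun y => f y = v i) y e).
exists (vdim [set f x | x in S]), u => x Sx.
have [|c xc] := sp (f x); first by exists x.
exists c; apply: fi; rewrite xc linear_sum; apply: eq_bigr => i _.
by rewrite linearZ hu.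
Qed.

(** * The positive-level subalgebra for the given Cartan matrix *)

Section A1pp.
Variable K : fieldType.
Hypothesis char0 : injective (fun z : int => z%:~R : K).
Local Notation g := (kacmoody K A1pp).
Local Notation L := (nposLie K).
Local Notation G := 'rV[int]_3.
Local Notation rs := (@rootspace K 3 A1pp).

Lemma A1pp_weightE (a : G) : [/\ km_weight A1pp a 0 = 2 * a 0 0 - a 0 1,
  km_weight A1pp a 1 = - a 0 0 + 2 * a 0 1 - 2 * a 0 2%:R
  & km_weight A1pp a 2%:R = - 2 * a 0 1 + 2 * a 0 2%:R].
Proof.
rewrite /km_weight !big_ord_recl !big_ord0 !mxE /=.
have -> : lift ord0 ord0 = 1 :> 'I_3 by apply/val_inj.
have -> : lift ord0 (lift ord0 ord0) = 2%:R :> 'I_3 by apply/val_inj.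
by split; ring.
Qed.

Definition root_weight (i : 'I_3) (a : G) : K := (km_weight A1pp a i)%:~R.

Lemma root_weight_is_zmod_morphism i : zmod_morphism (root_weight i).
Proof.
move=> a b; apply/eqP; rewrite eq_sym subr_eq /root_weight -intrD -km_weightD.
by rewrite subrK.
Qed.
HB.instance Definition _ i :=
  GRing.isZmodMorphism.Build G K (root_weight i) (root_weight_is_zmod_morphism i).

(** The determinant of [A1pp] is -2, so the integer values on the coroots determine a degree;
    [char0] carries this over to [K]. *)
Lemma root_weight_inj a b : a <> b -> exists i, root_weight i a <> root_weight i b.
Proof.
move=> ab; apply: contrapT => nx; apply: ab.
have e i : km_weight A1pp a i = km_weight A1pp b i.
  by apply: char0; apply: contrapT => ne; apply: nx; exists i.
have [a0 a1 a2] := A1pp_weightE a; have [b0 b1 b2] := A1pp_weightE b.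
have := e 0; have := e 1; have := e 2%:R; rewrite a0 a1 a2 b0 b1 b2 => h2 h1 h0.
by rewrite [a]root3E [b]root3E; congr root3; lia.
Qed.

Lemma word_weight_nonneg s (i : 'I_3) w k : 0 <= sgnb s * word_weight s i w 0 k :> int.
Proof.
have sq : sgnb s * sgnb s = 1 by case: s.
elim: w => [|j w IH] /=; rewrite !mxE; first by rewrite mulrA sq mul1r ler0n.
by rewrite mulrDr addr_ge0 // mulrA sq mul1r ler0n.
Qed.

Lemma height_word_weight (i : 'I_3) w : height (word_weight true i w) = (size w).+1.
Proof.
have hd j : height (sgnb true *: delta_mx 0 j) = 1.
  rewrite scale1r /height (bigD1 j) //= big1 ?addr0 ?mxE ?eqxx // => k kj.
  by rewrite mxE (negbTE kj).
elim: w => [|j w IH] /=; first exact: hd.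
by rewrite heightD hd IH; lia.
Qed.

(** Positive level rules out words in the [f_i], whose weights have no positive coordinate. *)
Lemma rootspace_words a x : 0 < level a -> rs a x ->
  x \in lspan [set x | exists i w, x = kmword K A1pp true i w /\ word_weight true i w = a].
Proof.
move=> la xa; have a0 : a <> 0 by move=> a0; rewrite a0 /level mxE ltxx in la.
apply: lspanS (rootspace_span root_weight_inj a0 xa) => y [[] [i [w [-> wa]]]].
  by exists i, w.
by have := word_weight_nonneg false i w 0; move: la; rewrite /level wa /= ; lia.
Qed.

Lemma rootspace_nonneg a x : 0 < level a -> rs a x -> x <> 0 -> nonneg a.
Proof.
move=> la xa x0; apply: contrapT => na; apply: x0.
have /lspanP := rootspace_words la xa; elim=> // c u v [i [w [_ wa]]] _ _.
by case: na => k; have := word_weight_nonneg true i w k; rewrite wa mul1r.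
Qed.

Lemma finspan_rootspace a : 0 < level a -> finspan (rs a).
Proof.
(* A word of weight [a] has as many letters as the height of [a]; the innermost letter is kept
   apart, hence the predecessor. *)
move=> la; pose k := (absz (height a)).-1.
apply: (@finspan_seq _ _ _ (codom (fun u : 'I_3 * k.-tuple 'I_3 => kmword K A1pp true u.1 u.2))).
move=> x xa; apply: lspanS (rootspace_words la xa) => y [i [w [-> wa]]].
have sw : size w == k by rewrite /k -wa height_word_weight.
by apply/codomP; exists (i, Tuple sw).
Qed.

Lemma npos_component a x : x \in @npos K -> rs a x -> level a <= 0 -> x = 0.
Proof.
move=> xn xa la.
apply: (@weight_indep _ _ _ _ (fun i => ad (km_h K A1pp i)) (fun a i => root_weight i a)
  root_weight_inj a) => //.
have /lspanP := xn; elim=> [|c u v [l l0 /lspanP ul] _ IHv]; first exact: rpred0.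
rewrite rpredD // rpredZ //; elim: ul => [|c' u' v' [b bl ub] _ IHv']; first exact: rpred0.
rewrite rpredD // rpredZ //; apply: lspan_incl; exists b => // ba.
by move: l0; rewrite -bl ba ltNge la.
Qed.

Lemma rootspace_npos a x : 0 < level a -> rs a x -> x \in @npos K.
Proof.
move=> la xa; apply: lspan_incl; exists (level a) => //.
by apply: lspan_incl; exists a.
Qed.

Lemma npos_lie_h i x : x \in @npos K -> lie (km_h K A1pp i) x \in @npos K.
Proof.
move=> /lspanP; elim=> [|c u v [l l0 /lspanP ul] _ IHv]; first by rewrite lie0r rpred0.
rewrite lie_linearr rpredD // rpredZ //.
elim: ul => [|c' u' v' [b bl ub] _ IHv']; first by rewrite lie0r rpred0.
rewrite lie_linearr rpredD // rpredZ // ub rpredZ //.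
by apply: (rootspace_npos (a := b)); rewrite ?bl.
Qed.

(** The coroots have level 0 and are not in [npos], but their adjoint action preserves it and
    supplies the operators whose eigenvalues separate degrees. *)
Definition npos_der (i : 'I_3) (x : L) : L :=
  Sub (lie (km_h K A1pp i) (val x)) (npos_lie_h i (valP x)).

Lemma npos_der_linear i : linear (npos_der i).
Proof. by move=> a x y; apply/val_inj; rewrite /= lie_linearr. Qed.
HB.instance Definition _ i :=
  GRing.isLinear.Build K L L *:%R (npos_der i) (npos_der_linear i).

Local Notation gr := (@npos_piece K).

Lemma npos_derE i a x : gr a x -> npos_der i x = root_weight i a *: x.
Proof. by move=> xa; apply/val_inj; rewrite /= xa. Qed.

Lemma npos_piece_lie b c y z : gr b y -> gr c z -> gr (b + c) (lie y z).
Proof. exact: rootspace_lie. Qed.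

Lemma npos_piece_span x : x \in lspan [set x | exists b, gr b x].
Proof.
suff lift z : z \in @npos K -> exists2 y : L, val y = z & y \in lspan [set x | exists b, gr b x].
  by have [y /val_inj <-] := lift _ (valP x).
move=> /lspanP; elim=> [|c u v [l l0 /lspanP ul] _ [v' <- hv']].
  by exists 0; rewrite ?rpred0.
suff [u' <- hu'] : exists2 y : L, val y = u & y \in lspan [set x | exists b, gr b x].
  by exists (c *: u' + v'); rewrite // rpredD // rpredZ.
elim: ul => [|c' w w' [b bl wb] _ [y' <- hy']]; first by exists 0; rewrite ?rpred0.
have wn : w \in @npos K by apply: (rootspace_npos (a := b)); rewrite ?bl.
exists (c' *: (Sub w wn : L) + y') => //.
by rewrite rpredD // rpredZ // lspan_incl //; exists b.
Qed.

Lemma npos_piece_level a x : gr a x -> x <> 0 -> 0 < level a.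
Proof.
move=> xa x0; rewrite ltNge; apply/negP => la; apply: x0; apply/val_inj.
exact: npos_component (valP x) xa la.
Qed.

Lemma subspace_npos_piece a : subspace (gr a).
Proof.
split=> [|c x y xa ya]; first by case: (@subspace_rootspace K 3 A1pp a).
exact: (@subspace_rootspace K 3 A1pp a).2.
Qed.

Lemma npos_pieceE a : 0 < level a ->
  [set (val : {linear L -> g}) x | x in gr a] = rs a.
Proof.
move=> la; apply/seteqP; split=> [_ [x xa <-] //|x xa].
by exists (Sub x (rootspace_npos la xa)).
Qed.

Lemma finspan_npos_piece a : finspan (gr a).
Proof.
have [la|la] := ltP 0 (level a).
  apply: (@finspan_inj _ _ _ (val : {linear L -> g})); first exact: val_inj.
    exact: subspace_npos_piece.
  by rewrite npos_pieceE //; apply: finspan_rootspace.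
exists 0, (fun=> 0) => x xa; exists (fun=> 0); rewrite big_ord0.
by apply: contrapT => x0; have := npos_piece_level xa x0; rewrite ltNge la.
Qed.

Lemma vdim_npos_piece a : 0 < level a -> vdim (gr a) = vdim (rs a).
Proof.
move=> la; rewrite (vdim_ker_img (val : {linear L -> g}) (subspace_npos_piece a)) //; last first.
  exact: finspan_npos_piece.
rewrite npos_pieceE // vdim_set0 // => x [_ /= x0].
exact/val_inj.
Qed.

Lemma npos_positive_grading : positive_grading gr.
Proof.
split.
- exact: subspace_npos_piece.
- exact: finspan_npos_piece.
- move=> b y yb y0; have lb := npos_piece_level yb y0.
  have nb : nonneg b.
    by apply: (rootspace_nonneg lb yb) => y0'; apply: y0; apply/val_inj.
  by split=> //; rewrite /height (bigD1 0) //= ltr_wpDr // sumr_ge0.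
- exact: npos_piece_lie.
- exact: (gr_direct npos_derE root_weight_inj).
Qed.

Lemma DserE m : odd m -> Dser K m = euler_series m gr.
Proof.
move=> om; apply/funext => a; apply/funext => b; apply/funext => c.
rewrite /euler_series -trunc_homology_odd //; first exact: npos_positive_grading.
by move=> n d w; apply: (bd_graded npos_derE root_weight_inj npos_piece_lie npos_piece_span).
Qed.

(** For negative coordinates [fs_coef] returns its default 0, and the root space is indeed 0 there,
    since at positive level only nonnegative degrees occur. *)
Lemma mult_dim_series (l d s : int) : 0 < l ->
  (mult K l d s)%:R = fs_coef (dim_series gr) l d s.
Proof.
move=> l0; rewrite /mult /km_mult /lds.
have la e : 0 < level (root3 l d e) by rewrite /level mxE.
case: eqVneq => [r0|_]; first by have := la (d + s); rewrite r0 /level mxE ltxx.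
have out e : ~ nonneg (root3 l d e) -> vdim (rs (root3 l d e)) = 0%N.
  move=> nn; apply: vdim_set0 => x xa; apply: contrapT => x0; apply: nn.
  exact: rootspace_nonneg (la e) xa x0.
case: l l0 la out => [a|a] // l0 la out; case: d la out => [b|b] la out /=; last first.
  by rewrite out // => /nonneg_root3[].
case: (_ + s) => [c|c]; first by rewrite -vdim_npos_piece.
by rewrite out // => /nonneg_root3[].
Qed.

End A1pp.

Theorem theorem5p2 (R : realType) (m : nat) (hm : odd m) :
  [/\ exists E : fseries,
        fs_mul (Dser (complex R) m) E = fs_one /\ fs_nonneg E,
      fs_nonneg (fs_neglog (Dser (complex R) m))
    & forall l d s : int, 0 < l ->
        (mult (complex R) l d s)%:R
          <= fs_coef (fs_neglog (Dser (complex R) m)) l d s].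
Proof.
have char0 : injective (fun z : int => z%:~R : complex R) by exact: intr_inj.
have gV := npos_positive_grading char0.
rewrite (DserE char0 hm); set F := euler_series _ _.
have bound N := euler_series_bound hm N gV; rewrite -/F in bound.
have [uF _ _] := bound 0%N.
have le a b c : (0 < a + b + c)%N ->
    dim_series (@npos_piece (complex R)) a b c <= fs_neglog F a b c.
  move=> pos; have [_ _ /(_ a b c (leqnn _))] := bound (a + b + c)%N.
  (* Both sides carry the height as a factor, which is positive here and cancels. *)
  rewrite fsB subr_ge0 -dneglogE // /euler ler_pM2l //.
  by rewrite ltr0n.
split.
- exists (fsinv F); split; first by rewrite fs_mulE mulr_fsinv // fs_oneE.
  by move=> a b c; have [_ /(_ a b c (leqnn _))] := bound (a + b + c)%N.
- move=> a b c; have [abc|abc] := posnP (a + b + c)%N.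
    (* At height 0 the sum that defines [fs_neglog] is empty. *)
    by rewrite /fs_neglog abc big_geq.
  by apply: le_trans (le a b c abc); rewrite ler0n.
move=> l d s l0; rewrite (mult_dim_series char0 d s l0) /fs_coef.
case: l l0 => [a|a] // l0; case: d => [b|b] //; case: (_ + _) => [c|c] //.
by apply: le; rewrite -addnA ltn_addr.
Qed.
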